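(* Let $\bar\Gamma$ be a topological network with boundary $\partial\Gamma$ and $\Gamma=\bar\Gamma\setminus\partial\Gamma$, and let $H=(H^j)_{j\in J}$ be a Hamiltonian of eikonal type on $\bar\Gamma$. Assume that there exist a closed subset $K\subset\Gamma$ and a function $f\in C(\Gamma)$ with $f(x)<0$ for all $x\in\Gamma\setminus K$. Let $u$ be a (viscosity) subsolution of $H(x,Du)=f(x)$, $x\in\Gamma\setminus K$, and let $v$ be a (viscosity) supersolution of $H(x,Du)=0$ in $\Gamma\setminus K$. If $u\le v$ on $\partial\Gamma\cup K$, then $u\le v$ in $\bar\Gamma$.
   Context: Topological network. Let $V=\{v_i: i\in I\}$ be a finite set of pairwise different points of $\mathbb R^N$ and let $\{\pi_j: j\in J\}$ be a finite collection of differentiable, non self-intersecting curves $\pi_j:[0,l_j]\to\mathbb R^N$, $l_j>0$. Put $e_j=\pi_j((0,l_j))$, $\bar e_j=\pi_j([0,l_j])$. Assume: (i) $\pi_j(0),\pi_j(l_j)\in V$ for all $j$; (ii) $\#(\bar e_j\cap V)=2$ for all $j$; (iii) $\bar e_j\cap\bar e_k\subset V$ and $\#(\bar e_j\cap\bar e_k)\le 1$ for $j\ne k$; (iv) any two $v,w\in V$ are joined by a finite sequence of edges in which consecutive edges satisfy $\#(\bar e\cap\bar e')=1$, $v$ belongs to the first closed edge and $w$ to the last. Then $\bar\Gamma=\bigcup_j\bar e_j$ is a topological network, with the subspace topology of $\mathbb R^N$. Let $Inc_i=\{j\in J: v_i\in\bar e_j\}$, and $a_{ij}=1$ if $\pi_j(0)=v_i$,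 $a_{ij}=-1$ if $\pi_j(l_j)=v_i$, $a_{ij}=0$ otherwise. A nonempty set $I_B\subset I$ is given, always with $i\in I_B$ whenever $\#(Inc_i)=1$; $\partial\Gamma=\{v_i:i\in I_B\}$ (boundary vertices), $I_T=I\setminus I_B$ (indices of transition vertices), $\Gamma=\bar\Gamma\setminus\partial\Gamma$. $C$, $USC$, $LSC$ denote continuous, upper and lower semicontinuous real functions. For $u:\bar\Gamma\to\mathbb R$, $u^j=u\circ\pi_j$, and $\partial_j u(x)$ is the derivative of $u^j$ at $\pi_j^{-1}(x)$ (for $x\in\bar e_j$; one-sided at vertices). Hamiltonian of eikonal type: a collection $H=(H^j)_{j\in J}$, $H^j:[0,l_j]\times\mathbb R\to\mathbb R$, such that: $H^j$ is continuous; $p\mapsto H^j(x,p)$ is convex for every $x\in[0,l_j]$; $H^j(x,p)\to+\infty$ as $|p|\to\infty$ for every $x\in[0,l_j]$; $H^j(\pi_j^{-1}(v_i),p)=H^k(\pi_k^{-1}(v_i),p)$ for all $p\in\mathbb R$, $i\in I$, $j,k\in Inc_i$; $H^j(\pi_j^{-1}(v_i),p)=H^j(\pi_j^{-1}(v_i),-p)$ for all $p\in\mathbb R$, $i\in I$, $j\in Inc_i$. For $x\in\bar e_j$ write $H^j(x,\partial_j\phi(x)):=H^j(\pi_j^{-1}(x),\partial_j\phi(x))$. Differentiability: $\phi\in C(\Gamma)$ is differentiable at $x\in e_j$ if $\phi^j$ is differentiable at $\pi_j^{-1}(x)$. At $x=v_i$, $i\in I_T$, for $j,k\in Inc_i$,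 $j\neq k$, $\phi$ is $(j,k)$-differentiable at $x$ if $\partial_j\phi(x),\partial_k\phi(x)$ exist and $a_{ij}\partial_j\phi(x)+a_{ik}\partial_k\phi(x)=0$. Viscosity sub/supersolutions. Let $\Omega\subset\Gamma$ and let $f$ be a real function on $\Gamma$ (possibly $f\equiv 0$). $u\in USC(\bar\Gamma)$ is a subsolution of $H(x,Du)=f(x)$ in $\Omega$ if: for every $x\in e_j\cap\Omega$ and every $\phi\in C(\Gamma)$ differentiable at $x$ such that $u-\phi$ has a local maximum at $x$, $H^j(x,\partial_j\phi(x))\le f(x)$; and for every $x=v_i\in\Omega$, $i\in I_T$, every $j,k\in Inc_i$, $j\ne k$, and every $\phi\in C(\Gamma)$ that is $(j,k)$-differentiable at $x$ and such that $u-\phi$ has a local maximum at $x$, $H^j(x,\partial_j\phi(x))\le f(x)$. $v\in LSC(\bar\Gamma)$ is a supersolution of $H(x,Du)=f(x)$ in $\Omega$ if: for every $x\in e_j\cap\Omega$ and every $\phi\in C(\Gamma)$ differentiable at $x$ such that $v-\phi$ has a local minimum at $x$, $H^j(x,\partial_j\phi(x))\ge f(x)$; and for every $x=v_i\in\Omega$, $i\in I_T$, and every $j\in Inc_i$ there exists $k\in Inc_i$, $k\ne j$, such that for every $\phi\in C(\Gamma)$ that is $(j,k)$-differentiable at $x$ and such that $v-\phi$ has a local minimum at $x$, $H^j(x,\partial_j\phi(x))\ge f(x)$. *)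

(* Defs.v *)
From HB Require Import structures.
From mathcomp Require Import all_boot all_order all_algebra.
From mathcomp Require Import all_classical all_reals all_analysis.

Set Implicit Arguments.
Unset Strict Implicit.
Unset Printing Implicit Defensive.

Import Order.TTheory GRing.Theory Num.Theory.
Import numFieldNormedType.Exports.

Local Open Scope classical_set_scope.
Local Open Scope ring_scope.
Local Open Scope card_scope.

(* Functions on a subset A of R^N are represented by total functions on R^N,
   of which only the values on A matter: every notion below is relative to the
   subspace topology of A.  The max norm of 'rV[R]_N induces the usual topology
   and the usual notion of differentiable curve. *)

Section OneVariable.
Variables (R : realType) (V : normedModType R).

(* Difference quotients at t over points of the closed interval [0, l], so that
   derivatives are one-sided at 0 and at l, and two-sided in between. *)
Definition diff_quotient (l : R) (g : R -> V) (t : R) : set_system V :=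
  (s - t)^-1 *: (g s - g t) @[s --> within `[0, l]%classic t^'].

Definition derivable_itv (l : R) (g : R -> V) (t : R) : Prop :=
  cvg (diff_quotient l g t).

Definition derive_itv (l : R) (g : R -> V) (t : R) : V :=
  lim (diff_quotient l g t).

End OneVariable.

Section Semicontinuity.
Variables (R : realType) (T : topologicalType).

Definition lsc_on (A : set T) (v : T -> R) : Prop :=
  @lower_semicontinuous (subspace A) R (fun x => (v x)%:E).

Definition usc_on (A : set T) (u : T -> R) : Prop :=
  @lower_semicontinuous (subspace A) R (fun x => (- u x)%:E).

Definition local_max_on (A : set T) (g : T -> R) (x : T) : Prop :=
  \forall y \near within A (nbhs x), g y <= g x.

Definition local_min_on (A : set T) (g : T -> R) (x : T) : Prop :=
  \forall y \near within A (nbhs x), g x <= g y.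

End Semicontinuity.

Record network_data (R : realType) (N : nat) (I J : finType) := NetworkData {
  vtx : I -> 'rV[R]_N;
  len : J -> R;
  curve : J -> R -> 'rV[R]_N;  (* only used on [0, len j] *)
  bnd : set I                  (* indices of the boundary vertices *)
}.

Section Network.
Variables (R : realType) (N : nat) (I J : finType).
Variable G : network_data R N I J.
Implicit Types (i : I) (j k : J) (x : 'rV[R]_N).

Definition edge j : set 'rV[R]_N := curve G j @` `]0, len G j[%classic.
Definition cedge j : set 'rV[R]_N := curve G j @` `[0, len G j]%classic.
Definition vertices : set 'rV[R]_N := range (vtx G).

Definition Inc i : set J := [set j | cedge j (vtx G i)].

Definition adjacent_edges j k : bool := `[< (cedge j `&` cedge k) #= `I_1 >].

Record is_network : Prop := IsNetwork {
  vtx_inj : injective (vtx G);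
  len_gt0 : forall j, 0 < len G j;
  curve_inj : forall j, {in `[0, len G j] &, injective (curve G j)};
  curve_derivable : forall j (t : R), t \in `[0, len G j] ->
    derivable_itv (len G j) (curve G j) t;
  curve_start : forall j, vertices (curve G j 0);
  curve_end : forall j, vertices (curve G j (len G j));
  cedge_vertices : forall j, (cedge j `&` vertices) #= `I_2;
  cedgeI_sub : forall j k, j != k -> cedge j `&` cedge k `<=` vertices;
  cedgeI_card : forall j k, j != k -> (cedge j `&` cedge k) #<= `I_1;
  network_connected : forall i i', exists (j : J) (s : seq J),
    [/\ path adjacent_edges j s, cedge j (vtx G i) & cedge (last j s) (vtx G i')];
  bnd_nonempty : bnd G !=set0;
  bnd_inc1 : forall i, Inc i #= `I_1 -> bnd G i
}.

Definition cnet : set 'rV[R]_N := \bigcup_j cedge j.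
Definition bnet : set 'rV[R]_N := vtx G @` bnd G.
Definition net : set 'rV[R]_N := cnet `\` bnet.

Definition orient i j : R :=
  if curve G j 0 == vtx G i then 1
  else if curve G j (len G j) == vtx G i then -1 else 0.

(* Inverse of the parametrization curve G j : [0, len G j] -> cedge j. *)
Definition edge_coord j : 'rV[R]_N -> R :=
  'pinv_(fun=> 0) `[0, len G j]%classic (curve G j).

Definition edge_derivable j (phi : 'rV[R]_N -> R) x : Prop :=
  derivable_itv (len G j) (phi \o curve G j : R -> R^o) (edge_coord j x).

Definition edge_derive j (phi : 'rV[R]_N -> R) x : R :=
  derive_itv (len G j) (phi \o curve G j : R -> R^o) (edge_coord j x).

Definition jk_derivable i j k (phi : 'rV[R]_N -> R) : Prop :=
  [/\ edge_derivable j phi (vtx G i), edge_derivable k phi (vtx G i) &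
      orient i j * edge_derive j phi (vtx G i)
      + orient i k * edge_derive k phi (vtx G i) = 0].

Record eikonal (H : J -> R -> R -> R) : Prop := Eikonal {
  eikonal_continuous : forall j,
    {within `[0, len G j]%classic `*` [set: R],
      continuous (fun tp : R * R => H j tp.1 tp.2)};
  eikonal_convex : forall j (t : R), t \in `[0, len G j] ->
    @convex_function R R^o setT (H j t);
  eikonal_coercive_pinfty : forall j (t : R), t \in `[0, len G j] ->
    H j t p @[p --> +oo] --> +oo;
  eikonal_coercive_ninfty : forall j (t : R), t \in `[0, len G j] ->
    H j t p @[p --> -oo] --> +oo;
  eikonal_vertex : forall i j k p, Inc i j -> Inc i k ->
    H j (edge_coord j (vtx G i)) p = H k (edge_coord k (vtx G i)) p;
  eikonal_even : forall i j p, Inc i j ->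
    H j (edge_coord j (vtx G i)) p = H j (edge_coord j (vtx G i)) (- p)
}.

Variables (H : J -> R -> R -> R) (f : 'rV[R]_N -> R) (Omega : set 'rV[R]_N).

Record subsolution (u : 'rV[R]_N -> R) : Prop := Subsolution {
  subsol_usc : usc_on cnet u;
  subsol_edge : forall j x, edge j x -> Omega x ->
    forall phi : 'rV[R]_N -> R, {within net, continuous phi} ->
      edge_derivable j phi x ->
      local_max_on net (fun y => u y - phi y) x ->
      H j (edge_coord j x) (edge_derive j phi x) <= f x;
  subsol_vertex : forall i, ~ bnd G i -> Omega (vtx G i) ->
    forall j k, Inc i j -> Inc i k -> j != k ->
    forall phi : 'rV[R]_N -> R, {within net, continuous phi} ->
      jk_derivable i j k phi ->
      local_max_on net (fun y => u y - phi y) (vtx G i) ->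
      H j (edge_coord j (vtx G i)) (edge_derive j phi (vtx G i)) <= f (vtx G i)
}.

Record supersolution (v : 'rV[R]_N -> R) : Prop := Supersolution {
  supersol_lsc : lsc_on cnet v;
  supersol_edge : forall j x, edge j x -> Omega x ->
    forall phi : 'rV[R]_N -> R, {within net, continuous phi} ->
      edge_derivable j phi x ->
      local_min_on net (fun y => v y - phi y) x ->
      f x <= H j (edge_coord j x) (edge_derive j phi x);
  supersol_vertex : forall i, ~ bnd G i -> Omega (vtx G i) ->
    forall j, Inc i j -> exists k, [/\ Inc i k, k != j &
    forall phi : 'rV[R]_N -> R, {within net, continuous phi} ->
      jk_derivable i j k phi ->
      local_min_on net (fun y => v y - phi y) (vtx G i) ->
      f (vtx G i) <= H j (edge_coord j (vtx G i)) (edge_derive j phi (vtx G i))]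
}.

End Network.

(* Main.v *)
Require Import Defs.
From HB Require Import structures.
From mathcomp Require Import all_boot all_order all_algebra.
From mathcomp Require Import all_classical all_reals all_analysis.
From mathcomp Require Import ring lra.

Import Order.TTheory GRing.Theory Num.Theory.
Import numFieldNormedType.Exports.

Local Open Scope classical_set_scope.
Local Open Scope ring_scope.

Set Implicit Arguments.
Unset Strict Implicit.
Unset Printing Implicit Defensive.

(** The theorem is a maximum principle.  If u exceeded v somewhere, then u - v
    would have a positive maximum over the compact set cnet
    ([difference_max]); the assumption on the boundary and on K forces the
    maximum point x into net minus K, where f x < 0.  The rest of the file shows
    that u - v has no maximum there ([net_max_contradiction]).

    Near x the network is a star: finitely many rays [0, r] glued at 0.  A
    transition vertex has one ray per incident edge; an interior point of an
    edge has two, one per direction.  Write U_a, V_a, h_a for u, v, H read along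
    the ray a with the derivative taken away from x.  Both kinds of points then
    satisfy the same rule: h_a(0, p) = h_b(0, - p) for distinct rays a and b.
    At a vertex this is evenness together with the agreement of the H^j; inside
    an edge it only expresses the reversal of the direction.  Likewise (j,k)-test
    functions at a vertex and ordinary test functions inside an edge are both
    described by outward slopes g with g_a + g_b = 0.

    On a star the contradiction comes from doubling the variables
    ([star_contradiction]).  One maximizes, over points (a, s) and (b, t),
      U_a(s) - V_b(t) - k d((a,s),(b,t))^2 - s^2
    where d is the distance along the star, |s - t| on one ray and s + t on two.
    The term s^2 makes the centre the only limit point of the maximizers as k
    tends to infinity, and its slope 2s vanishes there, so that it preserves the
    condition g_a + g_b = 0.  At a maximizer the penalty provides test functions
    for u and for v whose slopes p + 2s and q are, up to the change of ray,
    the same number: p = q if a = b, and p = - q otherwise.  Coercivity bounds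
    p, so continuity of h at the centre and the pairing rule make
    h_a(s, p + 2s) <= - c < 0 and h_b(t, q) >= 0 incompatible for large k.

    Two bridges connect stars with the network.  [near_cnet] says that the
    topology of cnet at x is the one seen along the curves through x, which turns
    estimates on rays into local extrema on net.  [test_function] builds a
    continuous function on the whole network with prescribed slopes at x and a
    prescribed quadratic shape near x: it is cut off on every edge so as to
    vanish at all vertices, which makes the pieces fit together. *)

(** * Maxima of families of semicontinuous functions *)

(** Without a maximum, the sets of indexed points where f is at least f z form a
    filter base; each point has a neighbourhood where f stays below the
    values along this filter, and compactness makes this uniform. *)
Lemma usc_family_max (R : realType) (X : topologicalType) (T : finType)
    (D : pred T) (A : T -> set X) (f : T -> X -> R) :
  (forall i, D i -> compact (A i)) ->
  (forall i x, D i -> A i x -> forall e : R, 0 < e ->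
    \forall y \near x, A i y -> f i y < f i x + e) ->
  (exists i x, D i /\ A i x) ->
  exists i x, [/\ D i, A i x & forall j y, D j -> A j y -> f j y <= f i x].
Proof.
move=> cA uscf [i0 [x0 [Di0 Ax0]]]; apply: contrapT => nomax.
pose dom := [set z : T * X | D z.1 /\ A z.1 z.2].
pose up (z : T * X) := [set w | dom w /\ f z.1 z.2 <= f w.1 w.2].
have lt_up z : dom z -> exists2 w, dom w & f z.1 z.2 < f w.1 w.2.
  case: z => i x [/= Di Ax]; apply: contrapT => nw; apply: nomax.
  exists i, x; split=> // j y Dj Ay; rewrite leNgt; apply/negP => lt.
  by apply: nw; exists (j, y).
have FF : ProperFilter (filter_from dom up).
  apply: filter_from_proper; last by move=> z domz; exists z; split.
  apply: filter_from_filter; first by exists (i0, x0).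
  move=> z w dz dw; have [le|le] := leP (f z.1 z.2) (f w.1 w.2).
    by exists w => // y [dy ley]; split; split=> //; apply: le_trans ley.
  by exists z => // y [dy ley]; split; split=> //;
    apply: le_trans ley; apply: ltW.
have near_up i : \forall w \near filter_from dom up,
    D i -> A i `<=` [set x | f i x < f w.1 w.2].
  have [Di|nDi] := boolP (D i); last by apply: nearW.
  have /compact_near_coveringP/near_covering_withinP cov := cA i Di.
  have := cov _ _ (fun w x => f i x < f w.1 w.2) FF.
  move=> /(_ _)/wrap[|H]; last by apply: filterS H => w H _.
  move=> x Ax; have [w dw ltw] := lt_up (i, x) (conj Di Ax).
  have e0 : 0 < f w.1 w.2 - f i x by rewrite subr_gt0.
  exists ([set y | A i y -> f i y < f w.1 w.2], up w).
    split=> /=; last by exists w.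
    apply: filterS (uscf _ _ Di Ax _ e0) => y /= Hy Ay.
    by rewrite (lt_le_trans (Hy Ay))// addrC subrK.
  by move=> [y z] [/= Hy [_ lez]] Ay; exact: lt_le_trans (Hy Ay) lez.
have near_all : \forall w \near filter_from dom up,
    forall i, D i -> A i `<=` [set x | f i x < f w.1 w.2].
  exact: filter_forall near_up.
have near_dom : \forall w \near filter_from dom up, dom w.
  by exists (i0, x0) => // w [].
have [w [domw Hw]] := @filter_ex _ _ FF _ (filterI near_dom near_all).
by have := Hw _ domw.1 _ domw.2; rewrite /= ltxx.
Qed.

(** * Doubling of variables on a star of rays *)

Section Star.
Variables (R : realType) (M : finType) (D : pred M).
Variables (U V : M -> R -> R) (h : M -> R -> R -> R) (r c P : R).

(** A family of functions on the rays is compared near the centre with parabolas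
    that share the curvature C but have their own outward slope on each ray. *)
Definition vertex_parabola_above (W : M -> R -> R) (g : M -> R) (C : R) :=
  forall m, D m -> \forall s \near (0:R), 0 <= s ->
    W m s <= W m 0 + g m * s + C * s ^+ 2.

Definition vertex_parabola_below (W : M -> R -> R) (g : M -> R) (C : R) :=
  forall m, D m -> \forall s \near (0:R), 0 <= s ->
    W m 0 + g m * s - C * s ^+ 2 <= W m s.

(* U, V and h are functions on the rays D, parametrized by [0, r] from the
   common centre 0.  subI, supI, subV, supV are the viscosity inequalities, for
   quadratic test functions only. *)
Hypotheses (r_gt0 : 0 < r) (c_gt0 : 0 < c).
Hypothesis U0 : forall a b, D a -> D b -> U a 0 = U b 0.
Hypothesis V0 : forall a b, D a -> D b -> V a 0 = V b 0.
Hypothesis U_usc : forall a s, D a -> 0 <= s <= r -> forall e, 0 < e ->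
  \forall s' \near s, 0 <= s' <= r -> U a s' < U a s + e.
Hypothesis V_lsc : forall a s, D a -> 0 <= s <= r -> forall e, 0 < e ->
  \forall s' \near s, 0 <= s' <= r -> V a s - e < V a s'.
Hypothesis max0 : forall a s, D a -> 0 <= s <= r ->
  U a s - V a s <= U a 0 - V a 0.
Hypothesis h_cont : forall a p, D a -> forall e, 0 < e ->
  \forall z \near ((0:R), p), 0 <= z.1 -> `|h a z.1 z.2 - h a 0 p| < e.
Hypothesis h_pair : forall a b p, D a -> D b -> a != b -> h a 0 p = h b 0 (- p).
Hypothesis h_coer : forall a s p, D a -> 0 <= s < r -> P <= `|p| -> 0 <= h a s p.
Hypothesis subI : forall a s p C, D a -> 0 < s < r ->
  (\forall s' \near s, U a s' <= U a s + p * (s' - s) + C * (s' - s) ^+ 2) ->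
  h a s p <= - c.
Hypothesis supI : forall a s p C, D a -> 0 < s < r ->
  (\forall s' \near s, V a s + p * (s' - s) - C * (s' - s) ^+ 2 <= V a s') ->
  0 <= h a s p.
Hypothesis subV : forall a b, D a -> D b -> a != b ->
  forall g C, g a + g b = 0 -> vertex_parabola_above U g C -> h a 0 (g a) <= - c.
Hypothesis supV : forall a, D a -> exists b, [/\ D b, b != a &
  forall g C, g a + g b = 0 -> vertex_parabola_below V g C -> 0 <= h a 0 (g a)].

(** The squared distance along the star: the way between two different rays
    passes through the centre. *)
Definition sqdist (a b : M) (s t : R) :=
  if a == b then (s - t) ^+ 2 else (s + t) ^+ 2.

Let Phi k a b (z : R * R) :=
  U a z.1 - V b z.2 - (k * sqdist a b z.1 z.2 + z.1 ^+ 2).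
Let sq := (`[0, r] `*` `[0, r] : set (R * R)).

Lemma sqP s t : 0 <= s <= r -> 0 <= t <= r -> sq (s, t).
Proof. by move=> hs ht; split; rewrite /= in_itv. Qed.

Lemma sqdist_continuous a b : continuous (fun z : R * R => sqdist a b z.1 z.2).
Proof.
move=> z; rewrite /sqdist; case: (a == b).
  apply: (@cvg_comp _ _ _ (fun z : R * R => z.1 - z.2)
    (fun x => x ^+ 2) _ (nbhs (z.1 - z.2))).
    by apply: cvgB; [exact: cvg_fst|exact: cvg_snd].
  exact: exprn_continuous.
apply: (@cvg_comp _ _ _ (fun z : R * R => z.1 + z.2)
  (fun x => x ^+ 2) _ (nbhs (z.1 + z.2))).
  by apply: cvgD; [exact: cvg_fst|exact: cvg_snd].
exact: exprn_continuous.
Qed.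

Lemma near_fst (s t : R) (Q : R -> Prop) :
  (\forall x \near s, Q x) -> \forall z \near (s, t), Q z.1.
Proof. by move=> H; apply: (@cvg_fst _ _ (nbhs s) (nbhs t)). Qed.

Lemma near_snd (s t : R) (Q : R -> Prop) :
  (\forall x \near t, Q x) -> \forall z \near (s, t), Q z.2.
Proof. by move=> H; apply: (@cvg_snd _ _ (nbhs s) (nbhs t)). Qed.

Lemma UV_usc a b s t e : D a -> D b -> 0 <= s <= r -> 0 <= t <= r -> 0 < e ->
  \forall z \near (s, t), sq z -> U a z.1 - V b z.2 < U a s - V b t + e.
Proof.
move=> Da Db hs ht e0.
have e2 : 0 < e / 2 by lra.
have H1 := near_fst t (U_usc Da hs e2).
have H2 := near_snd s (V_lsc Db ht e2).
apply: filterS2 H1 H2 => -[x y] /= H1 H2 [/=].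
by rewrite !in_itv /= => /H1 ? /H2 ?; lra.
Qed.

Lemma Phi_usc k a b z : D a -> D b -> sq z -> forall e, 0 < e ->
  \forall z' \near z, sq z' -> Phi k a b z' < Phi k a b z + e.
Proof.
case: z => s t Da Db [/= hs ht] e e0; have e2 : 0 < e / 2 by lra.
rewrite !in_itv /= in hs ht.
have H1 := UV_usc Da Db hs ht e2.
pose w (z : R * R) := k * sqdist a b z.1 z.2 + z.1 ^+ 2.
have H2 : \forall z \near (s, t), `|w (s, t) - w z| < e / 2.
  suff : w @ (s, t) --> w (s, t) by move=> /cvgrPdist_lt; exact.
  apply: cvgD; first by apply: cvgMr; exact: sqdist_continuous.
  apply: (@cvg_comp _ _ _ (fun z : R * R => z.1) (fun x => x ^+ 2) _ (nbhs s)).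
    exact: cvg_fst.
  exact: exprn_continuous.
apply: filterS2 H1 H2 => -[x y] /= H1 H2 /H1 H3.
by move: H2; rewrite /w /Phi /= ltr_norml => /andP[H4 H5]; lra.
Qed.


(** Uniform continuity in p, which is needed only at the centre and for slopes in
    a compact interval. *)
Lemma h_uniform Q : \forall d \near (0:R)^'+, forall a, D a -> forall p, `|p| <= Q ->
  forall s x, 0 <= s <= d -> `|x| <= d -> `|h a s (p + x) - h a 0 p| < c / 2.
Proof.
apply: filter_forall => a; have [Da|nDa] := boolP (D a); last exact: nearW.
pose Pr d p := forall s x, 0 <= s <= d -> `|x| <= d -> `|h a s (p + x) - h a 0 p| < c / 2.
have /compact_near_coveringP cov := @segment_compact R (- Q) Q.
suff H : \forall d \near (0:R)^'+, `[- Q, Q]%classic `<=` Pr d.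
  apply: filterS H => d H _ p pQ; apply: H.
  by rewrite /= in_itv /= -ler_norml.
apply: cov => p0 _; have c4 : 0 < c / 4 by rewrite divr_gt0 ?ltr0n.
have /nbhs_ballP [d /= d0 Hd] := h_cont p0 Da c4.
exists (ball p0 (d / 2), [set e | e < d / 2]).
  split=> /=; first by apply: nbhsx_ballx; lra.
  by apply: nbhs_right_lt; lra.
move=> [p e] /= [bp ed] s x /andP[s0 se] xe.
have bpE : `|p0 - p| < d / 2 by [].
have H1 : `|h a s (p + x) - h a 0 p0| < c / 4.
  apply: (Hd (s, p + x)) => //; split => /=.
    by rewrite /ball /= sub0r normrN ger0_norm//; lra.
  rewrite /ball /= opprD addrA; apply: le_lt_trans (ler_normB _ _) _; lra.
have H2 : `|h a 0 p - h a 0 p0| < c / 4.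
  apply: (Hd (0, p)) => //; split => /=; first exact: ballxx.
  by rewrite /ball /=; lra.
move: H1 H2; rewrite !ltr_norml => /andP[? ?] /andP[? ?]; apply/andP; split; lra.
Qed.

(** Points where the penalized difference reaches its value at the centre
    converge to the centre as k grows.  Off the diagonal the penalty k d^2 beats
    the locally bounded U - V; on the diagonal U - V is at most its value at the
    centre, so the term s^2 is decisive. *)
Lemma Phi_localize eta : 0 < eta -> \forall k \near +oo,
  forall a b, D a -> D b -> forall z, sq z -> U a 0 - V a 0 <= Phi k a b z ->
  z.1 < eta /\ z.2 < eta.
Proof.
move=> eta0; apply: filter_forall => a; apply: filter_forall => b.
have [Da|nDa] := boolP (D a); last exact: nearW.
have [Db|nDb] := boolP (D b); last exact: nearW.
pose Pr k z := U a 0 - V a 0 <= Phi k a b z -> z.1 < eta /\ z.2 < eta.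
have /compact_near_coveringP/near_covering_withinP cov : compact sq.
  by apply: compact_setX; exact: segment_compact.
suff H : \forall k \near +oo, sq `<=` Pr k.
  by apply: filterS H => k H _ _ z; exact: H.
apply: cov => -[s t] [/= ]; rewrite !in_itv /= => hs ht.
have [q0|q0] := ltP 0 (sqdist a b s t).
- set q := sqdist a b s t in q0.
  have q2 : 0 < q / 2 by lra.
  pose L := (U a s - V b t + 1 - (U a 0 - V a 0)) / (q / 2).
  exists ([set z | q / 2 < sqdist a b z.1 z.2 /\
      (sq z -> U a z.1 - V b z.2 < U a s - V b t + 1)],
      [set k | 0 < k /\ L < k]).
    split=> /=; last by apply: filterI; apply: nbhs_pinfty_gt; rewrite num_real.
    apply: filterI; last exact: UV_usc.
    have := @sqdist_continuous a b (s, t); move=> /cvgrPdist_lt /(_ _ q2).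
    by apply: filterS => z; rewrite -/q ltr_norml => /andP[]/=; lra.
  move=> [z k] /= [[z1 z2] [k0 Lk]] sqz; rewrite /Pr /Phi => Hle.
  exfalso; have := z2 sqz => H3.
  have H4 : k * (q / 2) <= k * sqdist a b z.1 z.2 by rewrite ler_pM2l// ltW.
  have := sqr_ge0 z.1; move: Lk; rewrite /L ltr_pdivrMr//; lra.
- have st : s = t /\ (a != b -> s = 0).
    move: q0; rewrite /sqdist; case: eqP => [ab|ab] q0; split=> //.
    + have := sqr_ge0 (s - t) => H1; have /eqP : (s - t) ^+ 2 = 0 by lra.
      by rewrite sqrf_eq0 => /eqP; lra.
    + have := sqr_ge0 (s + t) => H1; have /eqP : (s + t) ^+ 2 = 0 by lra.
      by rewrite sqrf_eq0 => /eqP; lra.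
    + have := sqr_ge0 (s + t) => H1; have /eqP : (s + t) ^+ 2 = 0 by lra.
      by rewrite sqrf_eq0 => /eqP; lra.
  have [<- s0] := st.
  have [seta|etas] := ltP s eta.
    exists ([set z | z.1 < eta /\ z.2 < eta], setT) => /=.
      split; last exact: filterT.
      by apply: filterI; [apply: (@near_fst s s (fun x => x < eta))|
        apply: (@near_snd s s (fun x => x < eta))]; exact: lt_nbhsl.
    by move=> [z k] /= [[? ?] _] _ _.
  have ab : a = b by apply/eqP; apply: contraLR etas => /s0 ->; rewrite -ltNge.
  subst b.
  have e4 : 0 < eta ^+ 2 / 4 by rewrite divr_gt0// exprn_gt0.
  exists ([set z | eta / 2 < z.1 /\
      (sq z -> U a z.1 - V a z.2 < U a s - V a s + eta ^+ 2 / 4)],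
      [set k | 0 < k]).
    split=> /=; last by apply: nbhs_pinfty_gt; rewrite num_real.
    apply: filterI; last exact: UV_usc.
    apply: (@near_fst s s (fun x => eta / 2 < x)); apply: lt_nbhsr; lra.
  move=> [z k] /= [[z1 z2] k0] sqz; rewrite /Pr /Phi => Hle.
  exfalso; have H3 := z2 sqz.
  have H4 := max0 Da hs.
  have H5 : 0 <= k * sqdist a a z.1 z.2.
    by apply: mulr_ge0; [exact: ltW|rewrite /sqdist eqxx sqr_ge0].
  have H6 : (eta / 2) ^+ 2 <= z.1 ^+ 2 by rewrite lerXn2r ?nnegrE; lra.
  rewrite expr_div_n in H6; lra.
Qed.


(** The centre lies on every ray.  If one of the two points of a maximizer is the
    centre, it can thus be put on the ray of the other one, which removes the
    mixed cases from the main argument. *)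
Lemma Phi_max k a0 : D a0 -> exists a b s t,
  [/\ D a, D b, 0 <= s <= r, 0 <= t <= r &
   (s = 0 \/ t = 0 -> a = b) /\
   forall a' b' s' t', D a' -> D b' -> 0 <= s' <= r -> 0 <= t' <= r ->
     Phi k a' b' (s', t') <= Phi k a b (s, t)].
Proof.
move=> Da0; have r0 := r_gt0.
have [|ab z Dz Az e e0||] := @usc_family_max R (R * R)%type (M * M)%type
  (fun ab => D ab.1 && D ab.2) (fun=> sq) (fun ab => Phi k ab.1 ab.2).
- by move=> *; apply: compact_setX; exact: segment_compact.
- by case/andP: Dz => Da Db; exact: Phi_usc.
- exists (a0, a0), (0, 0) => /=; rewrite Da0; split=> //; split=> /=;
  by rewrite in_itv /= lexx ltW.
move=> [a b] [[s t] [/= /andP[Da Db] [/= hs ht] Hmax]].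
rewrite !in_itv /= in hs ht.
have {}Hmax a' b' s' t' : D a' -> D b' -> 0 <= s' <= r -> 0 <= t' <= r ->
    Phi k a' b' (s', t') <= Phi k a b (s, t).
  move=> Da' Db' hs' ht'; apply: (Hmax (a', b') (s', t')); last exact: sqP.
  by rewrite /= Da' Db'.
have [s0|s0] := eqVneq s 0.
  exists b, b, s, t; split=> //; split=> // a' b' s' t' H1 H2 H3 H4.
  apply: (le_trans (Hmax _ _ _ _ H1 H2 H3 H4)); rewrite /Phi /= s0 (U0 Da Db).
  by rewrite /sqdist eqxx; case: ifP => _; rewrite ?sub0r ?add0r ?sqrrN.
have [t0|t0] := eqVneq t 0.
  exists a, a, s, t; split=> //; split=> // a' b' s' t' H1 H2 H3 H4.
  apply: (le_trans (Hmax _ _ _ _ H1 H2 H3 H4)); rewrite /Phi /= t0 (V0 Da Db).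
  by rewrite /sqdist eqxx; case: ifP => _; rewrite ?subr0 ?addr0.
exists a, b, s, t; split=> //; split=> // -[] /eqP; first by rewrite (negPf s0).
by rewrite (negPf t0).
Qed.

(** The slope pi of the penalty is the same for both points, read on the ray of
    the first one.  At the centre the penalty has outward slope with one sign on
    the ray of the other point and the opposite sign on all remaining rays, which
    is exactly an admissible family of slopes for any second ray. *)
Lemma star_contradiction a0 : D a0 -> False.
Proof.
move=> Da0; have r0 := r_gt0; have c0 := c_gt0.
have /filter_ex [d [Hh [d0 [d1 dr]]]] : \forall d \near (0:R)^'+,
    (forall a, D a -> forall p, `|p| <= P + 1 -> forall s x, 0 <= s <= d ->
      `|x| <= d -> `|h a s (p + x) - h a 0 p| < c / 2) /\
    0 < d /\ d < 1 /\ d < r.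
  apply: filterI; first exact: h_uniform.
  apply: filterI; first exact: nbhs_right_gt.
  by apply: filterI; apply: nbhs_right_lt.
have d2 : 0 < d / 2 by lra.
have [k [Hloc k0]] := filter_ex
  (filterI (Phi_localize d2) (nbhs_pinfty_gt (num_real (0 : R)))).
have [a [b [s [t [Da Db hs ht [ab Hmax]]]]]] := Phi_max k Da0.
have [] := Hloc _ _ Da Db (s, t) _ _.
- exact: sqP.
- rewrite (U0 Da Da0) (V0 Da Da0).
  have := Hmax a0 a0 0 0 Da0 Da0; rewrite lexx (ltW r0) => /(_ isT isT).
  by rewrite {1}/Phi /= /sqdist eqxx; apply: le_trans; lra.
rewrite /= => sd td.
pose pi := if a == b then 2 * k * (s - t) else 2 * k * (s + t).
have near_itv x : 0 < x < r -> \forall y \near x, 0 <= y <= r.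
  move=> /andP[x0 xr]; near=> y; apply/andP; split; apply: ltW; near: y.
    exact: lt_nbhsr.
  exact: lt_nbhsl.
have near0_itv : \forall y \near (0:R), 0 <= y -> 0 <= y <= r.
  near=> y; move=> ->; apply: ltW; near: y; exact: lt_nbhsl.
have Hsub : h a s (pi + 2 * s) <= - c.
  have [s0|s0] := ltP 0 s.
    have hs' : 0 < s < r by rewrite s0 /=; lra.
    apply: (@subI _ _ _ (k + 1) Da hs').
    apply: filterS (near_itv _ hs') => s' hs''.
    have := Hmax a b s' t Da Db hs'' ht; rewrite /Phi /= /pi /sqdist.
    case: eqP => _; lra.
  have {s0} s0 : s = 0 by lra.
  have abE := ab (or_introl s0); subst b; subst s.
  have [b [Db' ba _]] := supV Da.
  (* Outward slopes at the centre of k d^2 as a function of the first point. *)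
  pose g m := if m == a then - 2 * k * t else 2 * k * t.
  have -> : pi + 2 * 0 = g a by rewrite /g /pi eqxx; ring.
  apply: (@subV a b Da Db' _ g (k + 1)); first by rewrite eq_sym.
    by rewrite /g eqxx (negPf ba); ring.
  move=> m Dm; apply: filterS near0_itv => s' hs' /hs' {}hs'.
  have := Hmax m a s' t Dm Da hs' ht.
  rewrite /Phi /= /sqdist eqxx (U0 Da Dm) /g.
  case: eqP => _; lra.
have Hsup : 0 <= h b t (if a == b then pi else - pi).
  have [t0|t0] := ltP 0 t.
    have ht' : 0 < t < r by rewrite t0 /=; lra.
    apply: (@supI _ _ _ k Db ht').
    apply: filterS (near_itv _ ht') => t' ht''.
    have := Hmax a b s t' Da Db hs ht''; rewrite /Phi /= /pi /sqdist.
    case: eqP => _; lra.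
  have {t0} t0 : t = 0 by lra.
  have abE := ab (or_intror t0); subst b; subst t.
  have [b [Db' ba Hb]] := supV Da.
  (* The slopes of - k d^2 as a function of the second point; supV selects the
     ray b on which the slope must be opposite, and every b is suitable. *)
  pose g m := if m == a then 2 * k * s else - 2 * k * s.
  have -> : (if a == a then pi else - pi) = g a by rewrite /g /pi eqxx; ring.
  apply: (Hb g k); first by rewrite /g eqxx (negPf ba); ring.
  move=> m Dm; apply: filterS near0_itv => t' ht' /ht' {}ht'.
  have := Hmax a m s t' Da Dm hs ht'.
  rewrite /Phi /= /sqdist eqxx (V0 Da Dm) /g eq_sym.
  case: eqP => _; lra.
(* A slope beyond the coercivity threshold P contradicts Hsub; the margin 1
   absorbs the contribution 2 * s of the localizing term. *)
have piP : `|pi| <= P + 1.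
  have [le|lt] := leP P `|pi + 2 * s|.
    have hs' : 0 <= s < r by lra.
    have := h_coer Da hs' le; lra.
  have -> : pi = (pi + 2 * s) - 2 * s by ring.
  apply: le_trans (ler_normB _ _) _.
  have -> : `|2 * s| = 2 * s by rewrite ger0_norm//; lra.
  lra.
have hs' : 0 <= s <= d by lra.
have ht' : 0 <= t <= d by lra.
have Ha : `|h a s (pi + 2 * s) - h a 0 pi| < c / 2.
  by apply: Hh => //; rewrite ger0_norm; lra.
have Hb : `|h b t (if a == b then pi else - pi) -
            h b 0 (if a == b then pi else - pi)| < c / 2.
  have := Hh _ Db (if a == b then pi else - pi) _ t 0 ht'.
  by rewrite addr0 normr0; apply; [case: ifP => _; rewrite ?normrN|exact: ltW].
have hab : h b 0 (if a == b then pi else - pi) = h a 0 pi.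
  by have [<-//|ne] := eqVneq a b; rewrite (h_pair pi Da Db ne).
by move: Ha Hb; rewrite hab !ltr_norml => /andP[? ?] /andP[? ?]; lra.
Unshelve. all: by end_near. Qed.

End Star.

(** * Elementary facts of one-variable analysis *)

Lemma no_three_in_pair (T : Type) (A : set T) (x y z : T) :
  (A #<= `I_2)%card -> A x -> A y -> A z -> [\/ x = y, y = z | x = z].
Proof.
move=> /pcard_leP[f] Ax Ay Az.
have fI w : A w -> (f w < 2)%N by move=> Aw; have := @funS _ _ _ _ f _ Aw.
have fi v w : A v -> A w -> f v = f w -> v = w.
  by move=> Av Aw; apply: (@inj _ _ _ f); rewrite inE.
have := fI _ Ax; have := fI _ Ay; have := fI _ Az.
case Ex: (f x) => [|[|?]] //; case Ey: (f y) => [|[|?]] //;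
  case Ez: (f z) => [|[|?]] // _ _ _.
- by apply: Or31; apply: fi; rewrite ?Ex.
- by apply: Or31; apply: fi; rewrite ?Ex.
- by apply: Or33; apply: fi; rewrite ?Ex.
- by apply: Or32; apply: fi; rewrite ?Ey.
- by apply: Or32; apply: fi; rewrite ?Ey.
- by apply: Or33; apply: fi; rewrite ?Ex.
- by apply: Or31; apply: fi; rewrite ?Ex.
- by apply: Or31; apply: fi; rewrite ?Ex.
Qed.

Lemma near_affine (R : realType) (e c t0 : R) (Q : R -> Prop) :
  (\forall s \near e + c * t0, Q s) -> \forall t \near t0, Q (e + c * t).
Proof.
have : (fun t => e + c * t) @ t0 --> e + c * t0.
  by apply: cvgD; [exact: cvg_cst|apply: cvgMr; exact: cvg_id].
by move=> H /H.
Qed.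

Lemma cvg_id_punctured (R : realType) (D : set R) (t : R) :
  s @[s --> within D t^'] --> t.
Proof.
have H : within D t^' --> t.
  by apply: cvg_trans (cvg_within _) _; exact: nbhs_dnbhs.
exact: H.
Qed.

(** g s - g t is (s - t) times a convergent quotient. *)
Lemma derivable_itv_continuous (R : realType) (W : normedModType R) (l : R)
    (g : R -> W) (t : R) :
  derivable_itv l g t -> forall e, 0 < e ->
  \forall s \near t, 0 <= s <= l -> `|g t - g s| < e.
Proof.
move=> dg e e0.
have : (fun s => (s - t) *: ((s - t)^-1 *: (g s - g t))) @
    within `[0, l]%classic t^' --> 0 *: derive_itv l g t.
  apply: cvgZ; last exact: dg.
  rewrite -(subrr t); apply: cvgB; last exact: cvg_cst.
  exact: cvg_id_punctured.
rewrite scale0r => /cvgrPdist_lt /(_ _ e0) H.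
have {}H : \forall s \near t, s != t -> `[0, l]%classic s ->
    `|0 - (s - t) *: ((s - t)^-1 *: (g s - g t))| < e by exact: H.
apply: filterS H => s Hs hs; have [->|st] := eqVneq s t; first by rewrite subrr normr0.
have := Hs st; rewrite /= in_itv /= => /(_ hs).
by rewrite sub0r normrN scalerA mulfV ?subr_eq0// scale1r distrC.
Qed.

(** Properness of this filter makes the limit [derive_itv] unique, also for the
    one-sided derivatives at 0 and l. *)
Lemma within_itv_dnbhs_proper (R : realType) (l t : R) : 0 < l -> 0 <= t <= l ->
  ProperFilter (within `[0, l]%classic t^').
Proof.
move=> l0 ht; split; last exact: within_filter.
rewrite /within /= /dnbhs /within /= => /nbhs_ballP[d /= d0 Hd].
pose m := Num.min (d / 2) (l / 2).
have m0 : 0 < m by rewrite lt_min; apply/andP; split; lra.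
have md : m < d by rewrite gt_min; apply/orP; left; lra.
have ml : m <= l / 2 by rewrite ge_min lexx orbT.
have [t2|t2] := leP t (l / 2).
  apply: (Hd (t + m)); rewrite /= ?in_itv /=.
  - by rewrite /ball /= opprD addNKr normrN gtr0_norm.
  - by apply/eqP; lra.
  - by lra.
apply: (Hd (t - m)); rewrite /= ?in_itv /=.
- by rewrite /ball /= opprB addrC subrK gtr0_norm.
- by apply/eqP; lra.
- by lra.
Qed.

Lemma diff_quotient_parabola (R : realType) (l t p C : R) (g : R -> R^o) :
  0 < l -> 0 <= t <= l -> g t = 0 ->
  (\forall s \near t, 0 <= s <= l -> g s = p * (s - t) + C * (s - t) ^+ 2) ->
  derivable_itv l g t /\ derive_itv l g t = p.
Proof.
move=> l0 ht gt Hg; have PF := within_itv_dnbhs_proper l0 ht.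
have lim : diff_quotient l g t --> (p : R^o).
  have : (fun s => p + C * (s - t)) @ within `[0, l]%classic t^' --> p.
    rewrite -[X in _ --> X]addr0 -(mulr0 C) -(subrr t).
    apply: cvgD; first exact: cvg_cst.
    apply: cvgMr; apply: cvgB; last exact: cvg_cst.
    exact: cvg_id_punctured.
  apply: cvg_trans; apply: near_eq_cvg.
  suff : \forall s \near t, s != t -> `[0, l]%classic s ->
    p + C * (s - t) = (s - t)^-1 *: (g s - g t) by exact.
  apply: filterS Hg => s Hs st.
  rewrite /= in_itv /= => /Hs ->; rewrite gt subr0.
  have st0 : s - t != 0 by rewrite subr_eq0.
  by rewrite /GRing.scale /=; field.
split; first by apply/cvg_ex; exists p.
exact: cvg_lim.
Qed.

(** Multiplying a function that vanishes at t by chi leaves its germ at t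
    unchanged and makes it vanish at both ends of [0, l], whether t is one of
    these ends or not. *)
Lemma cutoff (R : realType) (l t : R) : 0 < l -> 0 <= t <= l ->
  exists chi : R -> R, [/\ continuous chi, \forall s \near t, chi s = 1,
    t != 0 -> chi 0 = 0 & t != l -> chi l = 0].
Proof.
move=> l0 ht.
(* The slope 2 / t makes c1 exceed 1 before truncation exactly beyond t / 2. *)
pose c1 s : R := if t == 0 then 1 else Num.min 1 (2 / t * s).
pose c2 s : R := if t == l then 1 else Num.min 1 (2 / (l - t) * (l - s)).
have cc1 : continuous c1.
  move=> s; rewrite /c1; case: (t == 0); first exact: cvg_cst.
  apply: (@continuous_min _ _ (fun=> 1) (fun s => 2 / t * s)); first exact: cvg_cst.
  by apply: cvgMr; exact: cvg_id.
have cc2 : continuous c2.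
  move=> s; rewrite /c2; case: (t == l); first exact: cvg_cst.
  apply: (@continuous_min _ _ (fun=> 1) (fun s => 2 / (l - t) * (l - s))); first exact: cvg_cst.
  by apply: cvgMr; apply: cvgB; [exact: cvg_cst|exact: cvg_id].
have n1 : \forall s \near t, c1 s = 1.
  rewrite /c1; have [_|t0] := eqVneq t 0; first by apply: (filterS _ filterT).
  have tp : 0 < t by rewrite lt_neqAle eq_sym t0; case/andP: ht.
  have : \forall s \near t, t / 2 < s by apply: lt_nbhsr; lra.
  apply: filterS => s hs; apply/min_idPl.
  by rewrite mulrAC ler_pdivlMr// mul1r; lra.
have n2 : \forall s \near t, c2 s = 1.
  rewrite /c2; have [_|t0] := eqVneq t l; first by apply: (filterS _ filterT).
  have tp : 0 < l - t by rewrite subr_gt0 lt_neqAle t0; case/andP: ht.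
  have : \forall s \near t, s < (l + t) / 2 by apply: lt_nbhsl; lra.
  apply: filterS => s hs; apply/min_idPl.
  by rewrite mulrAC ler_pdivlMr// mul1r; lra.
have ler01 : (0 : R) <= 1 by exact: ler01.
exists (fun s => c1 s * c2 s); split.
- by move=> s; apply: cvgM; [exact: cc1|exact: cc2].
- by apply: filterS2 n1 n2 => s -> ->; rewrite mulr1.
- by move=> /negPf t0; rewrite /c1 t0 mulr0 (min_idPr ler01) mul0r.
- by move=> /negPf t0; rewrite /c2 t0 subrr mulr0 (min_idPr ler01) mulr0.
Qed.

(** A convex function larger at q than at 0 keeps growing beyond q; coercivity at
    one point of an edge thus propagates to nearby points by comparing only the
    values at 0 and at two further slopes. *)
Lemma convex_above_chord (R : realType) (g : R -> R) (q p : R) :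
  @convex_function R R^o setT g -> g 0 < g q -> 0 < p * q -> `|q| <= `|p| ->
  g q <= g p.
Proof.
move=> cg g0q pq qp; have q0 : q != 0.
  by apply: contraTneq pq => ->; rewrite mulr0 ltxx.
have p0 : p != 0 by apply: contraTneq pq => ->; rewrite mul0r ltxx.
have tp : 0 < q / p.
  have -> : q / p = p * q / p ^+ 2 by field.
  by rewrite divr_gt0// exprn_even_gt0.
have t0 := ltW tp.
have t1 : q / p <= 1.
  have : `|q / p| <= 1 by rewrite normf_div ler_pdivrMr ?normr_gt0// mul1r.
  by apply: le_trans; exact: ler_norm.
have gq : g q <= q / p * g p + (1 - q / p) * g 0.
  have := cg (Itv01 t0 t1) p 0; rewrite !inE => /(_ Logic.I Logic.I).
  suff -> : conv (Itv01 t0 t1) (p : convex_lmodType R^o) 0 = q by [].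
  transitivity (q / p * p + (1 - q / p) * 0); first by [].
  by rewrite mulr0 addr0 divfK.
rewrite leNgt; apply/negP => lt_pq.
have : 0 < q / p * (g q - g p) by rewrite mulr_gt0// subr_gt0.
have : 0 <= (1 - q / p) * (g q - g 0) by rewrite mulr_ge0// subr_ge0// ltW.
lra.
Qed.

(** * Topology of the network *)

Section Network.
Variables (R : realType) (N : nat) (I J : finType) (G : network_data R N I J).
Hypothesis netG : is_network G.
Implicit Types (j k m : J) (t s : R) (x y : 'rV[R]_N).

Let lgt0 j : 0 < len G j := len_gt0 netG j.

Lemma curveI j s t : 0 <= s <= len G j -> 0 <= t <= len G j ->
  curve G j s = curve G j t -> s = t.
Proof. by move=> hs ht; apply: (curve_inj netG); rewrite in_itv. Qed.

Lemma cedgeP j x : cedge G j x <-> exists2 t, 0 <= t <= len G j & curve G j t = x.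
Proof.
split=> [[t]|[t ht <-]]; first by rewrite /= in_itv /= => ht <-; exists t.
by exists t => //; rewrite /= in_itv.
Qed.

Lemma curveK j t : 0 <= t <= len G j -> edge_coord G j (curve G j t) = t.
Proof.
move=> ht; apply: pinvKV; last by rewrite inE /= in_itv.
by move=> a b /set_mem /= ha /set_mem /= hb; exact: (curve_inj netG).
Qed.

Lemma edge_coordP j x : cedge G j x ->
  0 <= edge_coord G j x <= len G j /\ curve G j (edge_coord G j x) = x.
Proof. by move=> /cedgeP[t ht <-]; rewrite curveK. Qed.

Lemma curve_near j t e : 0 <= t <= len G j -> 0 < e ->
  \forall s \near t, 0 <= s <= len G j -> `|curve G j t - curve G j s| < e.
Proof.
move=> ht; apply: derivable_itv_continuous.
by apply: curve_derivable => //; rewrite in_itv.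
Qed.

(** The two ends of an edge already account for its two vertices. *)
Lemma curve_vertex j t : 0 <= t <= len G j -> vertices G (curve G j t) ->
  t = 0 \/ t = len G j.
Proof.
move=> ht vt; have l0 := lgt0 j.
have h0 : (0 : R) <= 0 <= len G j by lra.
have hl : 0 <= len G j <= len G j by lra.
have in_pair s : 0 <= s <= len G j -> vertices G (curve G j s) ->
  (cedge G j `&` vertices G) (curve G j s).
  by move=> hs vs; split=> //; apply/cedgeP; exists s.
have [] := @no_three_in_pair _ _ (curve G j 0) (curve G j t)
  (curve G j (len G j)) _ (in_pair _ h0 (curve_start netG j))
  (in_pair _ ht vt) (in_pair _ hl (curve_end netG j)).
- by have := cedge_vertices netG j; rewrite card_eq_le => /andP[].
- by move/(curveI h0 ht); left.
- by move/(curveI ht hl); right.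
- by move/(curveI h0 hl); lra.
Qed.

(** A neighbourhood of x in cnet is described by neighbourhoods, on each curve, of
    the parameters that hit x.  The reason is compactness of [0, len j]: parameters
    with other images stay at a positive distance from x. *)
Lemma near_cnet x (Q : 'rV[R]_N -> Prop) :
  (forall j t, 0 <= t <= len G j -> curve G j t = x ->
    \forall s \near t, 0 <= s <= len G j -> Q (curve G j s)) ->
  \forall y \near x, cnet G y -> Q y.
Proof.
move=> HQ.
suff H : \forall y \near x, forall j, `[0, len G j] `<=`
    [set t | curve G j t = y -> Q y].
  by apply: filterS H => y Hy [j _ [t ht ty]]; exact: (Hy j t ht).
suff Hj j : \forall y \near x, `[0, len G j] `<=` [set t | curve G j t = y -> Q y].
  exact: (@filter_forall _ _ _ _ (nbhs_filter x) Hj).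
have /compact_near_coveringP/near_covering_withinP cov := @segment_compact R 0 (len G j).
apply: (cov _ (nbhs x) (fun y t => curve G j t = y -> Q y)) => t.
rewrite /= in_itv /= => ht.
have [tx|tx] := eqVneq (curve G j t) x.
  exists ([set s | 0 <= s <= len G j -> Q (curve G j s)], setT) => /=.
    by split; [exact: HQ|exact: filterT].
  by move=> [s y] /= [Hs _]; rewrite in_itv /= => /Hs + <-.
have e0 : 0 < `|curve G j t - x| / 2 by rewrite divr_gt0// normr_gt0 subr_eq0.
exists ([set s | 0 <= s <= len G j ->
    `|curve G j t - curve G j s| < `|curve G j t - x| / 2],
  ball x (`|curve G j t - x| / 2)) => /=.
  by split; [exact: curve_near|exact: nbhsx_ballx].
move=> [s y] /= [Hs xy]; rewrite in_itv /= => /Hs H1 sy; exfalso.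
move: H1 xy; rewrite sy -ball_normE /= => H1 H2.
have := ler_distD y (curve G j t) x; rewrite (distrC y x); lra.
Qed.

Lemma continuous_on_net (phi : 'rV[R]_N -> R) :
  (forall j t, 0 <= t <= len G j -> forall e, 0 < e ->
    \forall s \near t, 0 <= s <= len G j ->
      `|phi (curve G j t) - phi (curve G j s)| < e) ->
  {within net G, continuous phi}.
Proof.
move=> Hphi; apply/subspace_continuousP => x [cx _]; apply/cvgrPdist_lt => e e0.
have : \forall y \near x, cnet G y -> `|phi x - phi y| < e.
  by apply: near_cnet => j t ht <-; exact: Hphi.
by apply: filterS => y Hy [cy _]; exact: Hy.
Qed.

(** Vanishing at all ends is the simplest condition under which functions given
    on the edges agree on overlaps, since different edges meet only at vertices. *)
Lemma glue_edges (psi : J -> R -> R) :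
  (forall j, psi j 0 = 0) -> (forall j, psi j (len G j) = 0) ->
  exists phi : 'rV[R]_N -> R, forall j t, 0 <= t <= len G j ->
    phi (curve G j t) = psi j t.
Proof.
move=> psi0 psil.
have compat j k t s : 0 <= t <= len G j -> 0 <= s <= len G k ->
    curve G j t = curve G k s -> psi j t = psi k s.
  move=> ht hs ts; have [jk|jk] := eqVneq j k.
    by subst k; rewrite (curveI ht hs ts).
  have vt : vertices G (curve G j t).
    apply: (cedgeI_sub netG jk); split; apply/cedgeP; first by exists t.
    by exists s.
  have [->|->] := curve_vertex ht vt; rewrite ts in vt;
  by have [->|->] := curve_vertex hs vt; rewrite ?psi0 ?psil.
pose E y w := exists j t, [/\ 0 <= t <= len G j, curve G j t = y & w = psi j t].
exists (fun y => xget 0 (E y)) => j t ht.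
have /(xgetPex 0)[k [s [hs st ->]]] : exists w, E (curve G j t) w.
  by exists (psi j t), j, t.
exact: compat.
Qed.

Lemma eikonal_near (H : J -> R -> R -> R) j t p (e : R) : eikonal G H ->
  0 <= t <= len G j -> 0 < e ->
  \forall z \near (t, p), 0 <= z.1 <= len G j -> `|H j t p - H j z.1 z.2| < e.
Proof.
move=> eikH ht e0.
have /subspace_continuousP := @eikonal_continuous _ _ _ _ _ _ eikH j.
move=> /(_ (t, p)); rewrite /= in_itv /= => /(_ (conj ht Logic.I)).
move=> /cvgrPdist_lt /(_ _ e0) H1.
have {}H1 : \forall z \near (t, p), (`[0, len G j]%classic `*` [set: R]) z ->
  `|H j t p - H j z.1 z.2| < e by exact: H1.
by apply: filterS H1 => z Hz hz; apply: Hz; split=> //=; rewrite in_itv.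
Qed.

(** At t coercivity makes H j t (+- P) exceed both H j t 0 and 0 with a margin;
    continuity transports these finitely many inequalities to nearby s, and
    convexity extends them to all slopes beyond P. *)
Lemma eikonal_coercive_near (H : J -> R -> R -> R) j t : eikonal G H ->
  0 <= t <= len G j -> \forall P \near +oo, \forall s \near t,
  0 <= s <= len G j -> forall p, P <= `|p| -> 0 <= H j s p.
Proof.
move=> eikH ht; have htI : t \in `[0, len G j] by rewrite in_itv.
have Hc p (e : R) : 0 < e -> \forall s \near t, 0 <= s <= len G j -> `|H j t p - H j s p| < e.
  move=> e0; have [[A B] [/= At Bp] AB] := eikonal_near p eikH ht e0.
  by apply: filterS At => s As; apply: (AB (s, p)); split=> //=; exact: nbhs_singleton.
pose L := Num.max 1 (H j t 0 + 1).
have [L1 L2] : 1 <= L /\ H j t 0 + 1 <= L by rewrite /L !le_max !lexx orbT.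
have /cvgryPge /(_ L) H1 := eikonal_coercive_pinfty eikH htI.
have H2 : \forall p \near +oo, L <= H j t (- p).
  have /cvgryPge /(_ L) H2 := eikonal_coercive_ninfty eikH htI.
  suff : (- p)%R @[p --> -oo] [set p | L <= H j t (- p)] by rewrite ninftyN.
  by apply: filterS H2 => p /=; rewrite opprK.
have P0 : \forall P \near +oo, (0 : R) < P by apply: nbhs_pinfty_gt; rewrite num_real.
apply: filterS3 H1 H2 P0 => P H1 H2 P0.
have h2 : (0 : R) < 1 / 2 by lra.
apply: filterS3 (Hc 0 _ h2) (Hc P _ h2) (Hc (- P) _ h2) => s A1 A2 A3 hs p Pp.
have cvx := @eikonal_convex _ _ _ _ _ _ eikH j s; rewrite in_itv /= in cvx.
move: (A1 hs) (A2 hs) (A3 hs); rewrite !ltr_norml => /andP[? ?] /andP[? ?] /andP[? ?].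
have nP : `|P| = P by rewrite gtr0_norm.
have [p0|p0] := leP 0 p.
  rewrite ger0_norm// in Pp.
  have : H j s P <= H j s p.
    apply: (@convex_above_chord _ (H j s)) => //; first exact: cvx.
    - by lra.
    - by rewrite mulr_gt0//; lra.
    - by rewrite nP ger0_norm.
  lra.
rewrite ltr0_norm// in Pp.
have : H j s (- P) <= H j s p.
  apply: (@convex_above_chord _ (H j s)) => //; first exact: cvx.
  - by lra.
  - by rewrite -mulrNN opprK mulr_gt0//; lra.
  - by rewrite normrN nP ltr0_norm.
lra.
Qed.

(** * Test functions with prescribed slopes *)

(** On each edge through x the quadratic with the required slope is multiplied by
    a cutoff, on the other edges the function is 0; all pieces vanish at the
    vertices and glue. *)
Lemma test_function x (p : J -> R) (C : R) :
  exists phi : 'rV[R]_N -> R, {within net G, continuous phi} /\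
  (forall m, cedge G m x -> [/\ edge_derivable G m phi x,
    edge_derive G m phi x = p m, phi x = 0 &
    \forall t \near edge_coord G m x, 0 <= t <= len G m ->
      phi (curve G m t) =
        p m * (t - edge_coord G m x) + C * (t - edge_coord G m x) ^+ 2]).
Proof.
pose tx m := edge_coord G m x.
pose q m t := p m * (t - tx m) + C * (t - tx m) ^+ 2.
have qtx m : q m (tx m) = 0 by rewrite /q subrr expr0n /= !mulr0 addr0.
have /choice[psi Hpsi] : forall m, exists psi : R -> R, [/\ continuous psi, psi 0 = 0,
    psi (len G m) = 0 & cedge G m x -> \forall t \near tx m, psi t = q m t].
  move=> m; have [mx|nmx] := pselect (cedge G m x); last first.
    by exists (fun=> 0); split=> //; exact: cst_continuous.
  have [ht _] := edge_coordP mx.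
  have [chi [cchi chi1 chi0 chil]] := cutoff (lgt0 m) ht.
  exists (fun t => q m t * chi t); split.
  - move=> t; apply: cvgM; last exact: cchi.
    have csub : s - tx m @[s --> t] --> t - tx m.
      by apply: cvgB; [exact: cvg_id|exact: cvg_cst].
    have csqr : (s - tx m) ^+ 2 @[s --> t] --> (t - tx m) ^+ 2.
      exact: (cvg_comp _ _ csub (@exprn_continuous _ 2 _)).
    by apply: cvgD; apply: cvgMr.
  - have [t0|/chi0->] := eqVneq (tx m) 0; last by rewrite mulr0.
    by rewrite -[in q _ _]t0 qtx mul0r.
  - have [t0|/chil->] := eqVneq (tx m) (len G m); last by rewrite mulr0.
    by rewrite -[in q _ _]t0 qtx mul0r.
  - by move=> _; apply: filterS chi1 => t ->; rewrite mulr1.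
have [phi Hphi] := @glue_edges psi
  (fun j => let: And4 _ a _ _ := Hpsi j in a) (fun j => let: And4 _ _ a _ := Hpsi j in a).
exists phi; split.
  apply: (continuous_on_net) => j t ht e e0.
  have [cpsi _ _ _] := Hpsi j.
  have /cvgrPdist_lt/(_ _ e0) := cpsi t; apply: filterS => s Hs hs.
  by rewrite !Hphi.
move=> m mx; have [ht cx] := edge_coordP mx.
have [_ _ _ /(_ mx) Hq] := Hpsi m.
have phix : phi x = 0 by rewrite -cx Hphi// (nbhs_singleton Hq) qtx.
have Hphiq : \forall t \near tx m, 0 <= t <= len G m -> phi (curve G m t) = q m t.
  by apply: filterS Hq => t <- hs; rewrite Hphi.
have [] := @diff_quotient_parabola R (len G m) (tx m) (p m) C
  (phi \o curve G m) (lgt0 m) ht _ Hphiq.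
  by rewrite /= cx.
by split.
Qed.

Lemma test_above x (p : J -> R) (C : R) (u : 'rV[R]_N -> R) : cnet G x ->
  (forall m, cedge G m x -> \forall t \near edge_coord G m x, 0 <= t <= len G m ->
     u (curve G m t) <=
       u x + p m * (t - edge_coord G m x) + C * (t - edge_coord G m x) ^+ 2) ->
  exists phi, [/\ {within net G, continuous phi},
    forall m, cedge G m x -> edge_derivable G m phi x /\ edge_derive G m phi x = p m &
    local_max_on (net G) (fun y => u y - phi y) x].
Proof.
move=> [j0 _ j0x] Hu; have [phi [cphi Hphi]] := test_function x p C.
exists phi; split=> //; first by move=> m /Hphi[].
have [_ _ phix _] := Hphi _ j0x.
have : \forall y \near x, cnet G y -> u y - phi y <= u x - phi x.
  apply: (near_cnet) => j t ht tx.
  have jx : cedge G j x by apply/cedgeP; exists t.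
  have [_ _ _ H1] := Hphi _ jx; have H2 := Hu _ jx.
  rewrite -tx (curveK) // tx in H1 H2.
  apply: filterS2 H1 H2 => s H1 H2 hs; rewrite (H1 hs) phix; have := H2 hs; lra.
by apply: filterS => y Hy [cy _]; exact: Hy.
Qed.

Lemma test_below x (p : J -> R) (C : R) (v : 'rV[R]_N -> R) : cnet G x ->
  (forall m, cedge G m x -> \forall t \near edge_coord G m x, 0 <= t <= len G m ->
     v x + p m * (t - edge_coord G m x) - C * (t - edge_coord G m x) ^+ 2 <=
     v (curve G m t)) ->
  exists phi, [/\ {within net G, continuous phi},
    forall m, cedge G m x -> edge_derivable G m phi x /\ edge_derive G m phi x = p m &
    local_min_on (net G) (fun y => v y - phi y) x].
Proof.
move=> [j0 _ j0x] Hv; have [phi [cphi Hphi]] := test_function x p (- C).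
exists phi; split=> //; first by move=> m /Hphi[].
have [_ _ phix _] := Hphi _ j0x.
have : \forall y \near x, cnet G y -> v x - phi x <= v y - phi y.
  apply: (near_cnet) => j t ht tx.
  have jx : cedge G j x by apply/cedgeP; exists t.
  have [_ _ _ H1] := Hphi _ jx; have H2 := Hv _ jx.
  rewrite -tx (curveK) // tx in H1 H2.
  apply: filterS2 H1 H2 => s H1 H2 hs; rewrite (H1 hs) phix; have := H2 hs; lra.
by apply: filterS => y Hy [cy _]; exact: Hy.
Qed.



(** * Rays around a point *)

Lemma curve_cvg_within j t (Q : 'rV[R]_N -> Prop) : 0 <= t <= len G j ->
  (\forall y \near curve G j t, cnet G y -> Q y) ->
  \forall s \near t, 0 <= s <= len G j -> Q (curve G j s).
Proof.
move=> ht /nbhs_ballP[e /= e0 He].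
apply: filterS (curve_near ht e0) => s Hs hs; apply: He.
  by rewrite -ball_normE /=; exact: Hs.
by exists j => //; apply/cedgeP; exists s.
Qed.

Lemma lower_semicontinuous_near (A : set 'rV[R]_N) (w : 'rV[R]_N -> R) x (e : R) :
  @lower_semicontinuous (subspace A) R (fun y => (w y)%:E) -> A x -> 0 < e ->
  \forall y \near x, A y -> w x - e < w y.
Proof.
move=> lsc Ax e0; have [|B Bx HB] := lsc x (w x - e); first by rewrite lte_fin; lra.
have {Bx} : within A (nbhs x) B by rewrite nbhs_subspace_in.
by apply: filterS => y By; have := HB _ By; rewrite lte_fin.
Qed.

Lemma vertex_coord x j : vertices G x -> cedge G j x ->
  edge_coord G j x = 0 \/ edge_coord G j x = len G j.
Proof.
by move=> vx /edge_coordP[ht cx]; apply: curve_vertex => //; rewrite cx.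
Qed.

Lemma interior_coord x j : ~ vertices G x -> cedge G j x ->
  0 < edge_coord G j x < len G j.
Proof.
move=> nvx /edge_coordP[/andP[t0 tl] cx]; rewrite !lt_neqAle t0 tl !andbT.
apply/andP; split; apply/eqP => tE; apply: nvx; rewrite -cx.
  by rewrite -tE; exact: (curve_start netG).
by rewrite tE; exact: (curve_end netG).
Qed.

Lemma interior_edge x j k : ~ vertices G x -> cedge G j x -> cedge G k x -> j = k.
Proof.
by move=> nvx jx kx; apply/eqP; apply: contra_notT nvx => /(cedgeI_sub netG); apply.
Qed.

Lemma inside_not_vertex j t : 0 < t < len G j -> ~ vertices G (curve G j t).
Proof.
move=> ht vt; have ht' : 0 <= t <= len G j by lra.
by have [] := curve_vertex ht' vt; lra.
Qed.

Lemma inside_net j t : 0 < t < len G j -> net G (curve G j t).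
Proof.
move=> ht; split.
  by exists j => //; apply/cedgeP; exists t => //; lra.
by move=> [i _ vi]; apply: (inside_not_vertex ht); exists i.
Qed.

Lemma edge_inside j t : 0 < t < len G j -> edge G j (curve G j t).
Proof. by move=> ht; exists t => //; rewrite /= in_itv. Qed.

Lemma near_right (Q : R -> Prop) :
  (\forall s \near (0:R), 0 <= s -> Q s) ->
  \forall d \near (0:R)^'+, forall s, 0 <= s <= d -> Q s.
Proof.
move=> /nbhs_ballP[e /= e0 He]; near=> d => s /andP[s0 sd]; apply: He => //.
rewrite /ball /= sub0r normrN ger0_norm//; apply: le_lt_trans sd _; near: d.
exact: nbhs_right_lt.
Unshelve. all: by end_near. Qed.

(** A ray from x is an edge with a direction of travel, true standing for
    increasing parameters. *)
Definition ray_sign (b : bool) : R := if b then 1 else -1.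

Definition ray_coord x (a : J * bool) s : R := edge_coord G a.1 x + ray_sign a.2 * s.

Definition ray_room x (a : J * bool) : R :=
  if a.2 then len G a.1 - edge_coord G a.1 x else edge_coord G a.1 x.

Definition is_ray x (a : J * bool) : bool :=
  `[< cedge G a.1 x /\ 0 < ray_room x a >].

Lemma ray_signK b s : ray_sign b * (ray_sign b * s) = s.
Proof. by rewrite /ray_sign; case: b; rewrite ?mul1r ?mulN1r ?opprK. Qed.

Lemma ray_sign_sqr b s : (ray_sign b * s) ^+ 2 = s ^+ 2.
Proof. by rewrite exprMn /ray_sign; case: b; rewrite ?sqrrN expr1n mul1r. Qed.

Lemma ray_coordB x a s :
  (ray_coord x a s - edge_coord G a.1 x) ^+ 2 = s ^+ 2.
Proof. by rewrite /ray_coord addrC addKr ray_sign_sqr. Qed.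

Lemma ray_coordK x a s t :
  ray_coord x a (s + ray_sign a.2 * (t - ray_coord x a s)) = t.
Proof.
by rewrite {1}/ray_coord mulrDr ray_signK addrA -/(ray_coord x a s) addrC subrK.
Qed.

Lemma near_ray_coord x a s (Q : R -> Prop) : (\forall s' \near s, Q s') ->
  \forall t \near ray_coord x a s, Q (s + ray_sign a.2 * (t - ray_coord x a s)).
Proof.
move=> HQ; have : \forall s' \near (s - ray_sign a.2 * ray_coord x a s) +
    ray_sign a.2 * ray_coord x a s, Q s' by rewrite subrK.
by move=> /near_affine; apply: filterS => t; rewrite mulrBr addrA addrAC.
Qed.

Lemma ray_coord0 x a : is_ray x a -> ray_coord x a 0 = edge_coord G a.1 x /\
  curve G a.1 (ray_coord x a 0) = x.
Proof.
move=> /asboolP[cx _]; rewrite /ray_coord mulr0 addr0; split=> //.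
by have [] := edge_coordP cx.
Qed.

Lemma ray_coord_itv x a s : is_ray x a -> 0 <= s <= ray_room x a ->
  0 <= ray_coord x a s <= len G a.1.
Proof.
move=> /asboolP[/edge_coordP[ht _] _]; rewrite /ray_room /ray_coord /ray_sign.
by case: a.2 => hs; lra.
Qed.

Lemma ray_coord_inside x a s : is_ray x a -> 0 < s < ray_room x a ->
  0 < ray_coord x a s < len G a.1.
Proof.
move=> /asboolP[/edge_coordP[ht _] _]; rewrite /ray_room /ray_coord /ray_sign.
by case: a.2 => hs; lra.
Qed.

(** Two different rays are either the two directions at an interior point of an
    edge, or lie on different edges at a vertex: an edge leaves each of its ends
    in one direction only. *)
Lemma rays_opposite x a b : is_ray x a -> is_ray x b -> a != b ->
  (~ vertices G x /\ b = (a.1, ~~ a.2)) \/ (vertices G x /\ a.1 != b.1).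
Proof.
move: a b => [j c] [k d] ja kb ab.
have [jx j0] := asboolP _ ja; have [kx k0] := asboolP _ kb; rewrite /= in jx kx.
have [vx|nvx] := pselect (vertices G x); last first.
  left; split=> //; have jk := interior_edge nvx jx kx; subst k.
  by move: ab; rewrite /= xpair_eqE eqxx /=; case: c {ja j0} => /=; case: d {kb k0}.
right; split=> //=; apply: contraNneq ab => jk; subst k.
have l0 := lgt0 j; move: j0 k0; rewrite /ray_room /=.
have [->|->] := vertex_coord vx jx; case: c {ja} => /=; case: d {kb} => //=; lra.
Qed.

Lemma opposite_ray x a : ~ vertices G x -> is_ray x a -> is_ray x (a.1, ~~ a.2).
Proof.
move=> nvx /asboolP[ax _]; apply/asboolP; split=> //.
by have := interior_coord nvx ax; rewrite /ray_room /=; case: a.2 => /=; lra.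
Qed.

Lemma cedge_ray x j : cedge G j x -> exists b, is_ray x (j, b).
Proof.
move=> jx; have l0 := lgt0 j; have [ht _] := edge_coordP jx.
have [t0|t0] := ltP 0 (edge_coord G j x); first by exists false; apply/asboolP.
by exists true; apply/asboolP; split=> //; rewrite /ray_room /=; lra.
Qed.

(** At a vertex the sign a_ij is the direction in which the edge leaves it, so
    a_ij times the derivative is the outward slope. *)
Lemma orient_ray i a : is_ray (vtx G i) a -> orient G i a.1 = ray_sign a.2.
Proof.
case: a => j b /= aj; have [jx r0] := asboolP _ aj; have l0 := lgt0 j.
have [_ cx] := edge_coordP jx; rewrite /= in jx cx; rewrite /ray_room /= in r0.
have vx : vertices G (vtx G i) by exists i.
rewrite /orient; have [t0|tl] := vertex_coord vx jx.
  rewrite t0 in cx r0; rewrite cx eqxx; case: b {aj} r0 => //=; lra.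
rewrite tl in cx r0; rewrite cx eqxx; case: b {aj} r0 => /=; first lra.
move=> _; case: eqP => // c0; have : 0 = len G j; last lra.
by apply: (@curveI j); rewrite ?c0 ?cx //; lra.
Qed.

(** Outward slopes on the rays define a derivative on each edge through x
    provided that opposite rays of one edge carry opposite slopes.  The relation
    A m t w stands for the comparison at parameter t of edge m with linear part
    w, so that the lemma serves comparisons from above and from below. *)
Lemma slopes_of_rays x (g : J * bool -> R) (A : J -> R -> R -> Prop) :
  (forall j, is_ray x (j, true) -> is_ray x (j, false) ->
     g (j, true) + g (j, false) = 0) ->
  (forall m, cedge G m x -> A m (edge_coord G m x) 0) ->
  (forall a, is_ray x a -> \forall s \near (0:R), 0 <= s ->
     A a.1 (ray_coord x a s) (g a * s)) ->
  exists p : J -> R, (forall a, is_ray x a -> p a.1 = ray_sign a.2 * g a) /\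
    forall m, cedge G m x -> \forall t \near edge_coord G m x,
      0 <= t <= len G m -> A m t (p m * (t - edge_coord G m x)).
Proof.
move=> g0 A0 HA.
exists (fun m => if is_ray x (m, true) then g (m, true) else - g (m, false)); split.
  move=> [m [|]] /= am; rewrite ?am /ray_sign ?mul1r ?mulN1r//.
  by case: ifP => // mt; have := g0 _ mt am; lra.
move=> m mx; set tx := edge_coord G m x.
have Hb b : \forall t \near tx, is_ray x (m, b) -> 0 <= ray_sign b * (t - tx) ->
    A m t (g (m, b) * (ray_sign b * (t - tx))).
  have [ab|nab] := boolP (is_ray x (m, b)); last first.
    by apply: (filterS _ filterT) => t _.
  have H0 : \forall s \near (- ray_sign b * tx) + ray_sign b * tx, 0 <= s ->
      A m (ray_coord x (m, b) s) (g (m, b) * s).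
    by rewrite mulNr addNr; exact: (HA (m, b) ab).
  apply: filterS (near_affine H0) => t; rewrite mulNr addrC -mulrBr.
  by rewrite /ray_coord /= ray_signK -/tx [tx + _]addrC subrK => + _.
apply: filterS2 (Hb true) (Hb false) => t Ht Hf ht.
have [tt|tt|te] := ltgtP tx t; last by rewrite -te subrr mulr0; exact: A0.
  have rt : is_ray x (m, true) by apply/asboolP; split=> //; rewrite /ray_room /= -/tx; lra.
  rewrite rt; have := Ht rt; rewrite /ray_sign mul1r; apply; lra.
have rf : is_ray x (m, false).
  by apply/asboolP; split=> //; rewrite /ray_room /= -/tx; lra.
have -> : (if is_ray x (m, true) then g (m, true) else - g (m, false)) = - g (m, false).
  by case: ifP => // rt; have := g0 _ rt rf; lra.
have := Hf rf; rewrite /ray_sign mulN1r mulrN -mulNr; apply; lra.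
Qed.


(** * Viscosity inequalities in terms of rays *)

Section Tests.
Variables (H : J -> R -> R -> R) (f : 'rV[R]_N -> R) (Omega : set 'rV[R]_N).

Lemma subsolution_inside u j t p C : subsolution G H f Omega u ->
  0 < t < len G j -> Omega (curve G j t) ->
  (\forall s \near t, u (curve G j s) <=
     u (curve G j t) + p * (s - t) + C * (s - t) ^+ 2) ->
  H j t p <= f (curve G j t).
Proof.
move=> subu ht Ot Hu; have ht' : 0 <= t <= len G j by lra.
have nvt := inside_not_vertex ht; have jt := edge_inside ht.
have [ct _] := inside_net ht.
have cjt : cedge G j (curve G j t) by apply/cedgeP; exists t.
have [m mt|phi [cphi dphi maxphi]] := @test_above _ (fun=> p) C u ct.
  have mj := interior_edge nvt mt cjt; subst m.
  by rewrite curveK//; apply: filterS Hu => s.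
have [d1 d2] := dphi _ cjt.
by have := subsol_edge subu jt Ot cphi d1 maxphi; rewrite d2 curveK.
Qed.

Lemma supersolution_inside v j t p C : supersolution G H f Omega v ->
  0 < t < len G j -> Omega (curve G j t) ->
  (\forall s \near t, v (curve G j t) + p * (s - t) - C * (s - t) ^+ 2 <=
     v (curve G j s)) ->
  f (curve G j t) <= H j t p.
Proof.
move=> supv ht Ot Hv; have ht' : 0 <= t <= len G j by lra.
have nvt := inside_not_vertex ht; have jt := edge_inside ht.
have [ct _] := inside_net ht.
have cjt : cedge G j (curve G j t) by apply/cedgeP; exists t.
have [m mt|phi [cphi dphi minphi]] := @test_below _ (fun=> p) C v ct.
  have mj := interior_edge nvt mt cjt; subst m.
  by rewrite curveK//; apply: filterS Hv => s.
have [d1 d2] := dphi _ cjt.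
by have := supersol_edge supv jt Ot cphi d1 minphi; rewrite d2 curveK.
Qed.

(** If an edge leaves x in both directions, then these are the only two rays, so
    the admissibility of the slopes for one pair of rays is the condition needed
    by [slopes_of_rays]. *)
Lemma opposite_slopes x a b (g : J * bool -> R) : is_ray x a -> is_ray x b ->
  a != b -> g a + g b = 0 ->
  forall j, is_ray x (j, true) -> is_ray x (j, false) ->
  g (j, true) + g (j, false) = 0.
Proof.
move=> ax bx ab gab j jt jf.
have jtf : (j, true) != (j, false) by rewrite xpair_eqE eqxx.
have [[nvx _]|[_]] := rays_opposite jt jf jtf; last by rewrite /= eqxx.
have [[_ bE]|[vx _]] := rays_opposite ax bx ab; last by case: (nvx vx).
rewrite bE in gab.
have [aj _] := asboolP _ ax; have [jj _] := asboolP _ jt.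
have E := interior_edge nvx aj jj; rewrite /= in E.
case: a E gab {ax ab aj bE} => k c /= ->; case: c => //=.
by rewrite addrC.
Qed.

Lemma edge_of_point x j : ~ vertices G x -> cedge G j x -> edge G j x.
Proof.
move=> nvx jx; have := interior_coord nvx jx.
by have [_ {3}<-] := edge_coordP jx; apply: edge_inside.
Qed.

Lemma test_above_star x a b (g : J * bool -> R) C (u : 'rV[R]_N -> R) :
  net G x -> is_ray x a -> is_ray x b -> a != b -> g a + g b = 0 ->
  (forall m : J * bool, is_ray x m -> \forall s \near (0 : R), 0 <= s ->
     u (curve G m.1 (ray_coord x m s)) <= u x + g m * s + C * s ^+ 2) ->
  exists phi : 'rV[R]_N -> R, [/\ {within net G, continuous phi},
    forall m : J * bool, is_ray x m -> edge_derivable G m.1 phi x /\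
      edge_derive G m.1 phi x = ray_sign m.2 * g m &
    local_max_on (net G) (fun y => u y - phi y) x].
Proof.
move=> nx ax bx ab gab Hu.
pose A m t w := u (curve G m t) <= u x + w + C * (t - edge_coord G m x) ^+ 2.
have [|m mx|m mx|p [pE Hp]] := @slopes_of_rays x g A.
- exact: opposite_slopes ax bx ab gab.
- have [_ cx] := edge_coordP mx.
  by rewrite /A cx subrr expr0n /= mulr0 !addr0.
- by apply: filterS (Hu m mx) => s Hs s0; rewrite /A ray_coordB; exact: Hs.
have [phi [cphi dphi maxphi]] := test_above nx.1 Hp.
exists phi; split=> // m mx; have [cm _] := asboolP _ mx.
by rewrite -pE //; exact: dphi.
Qed.

Lemma test_below_star x a b (g : J * bool -> R) C (v : 'rV[R]_N -> R) :
  net G x -> is_ray x a -> is_ray x b -> a != b -> g a + g b = 0 ->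
  (forall m : J * bool, is_ray x m -> \forall s \near (0 : R), 0 <= s ->
     v x + g m * s - C * s ^+ 2 <= v (curve G m.1 (ray_coord x m s))) ->
  exists phi : 'rV[R]_N -> R, [/\ {within net G, continuous phi},
    forall m : J * bool, is_ray x m -> edge_derivable G m.1 phi x /\
      edge_derive G m.1 phi x = ray_sign m.2 * g m &
    local_min_on (net G) (fun y => v y - phi y) x].
Proof.
move=> nx ax bx ab gab Hv.
pose A m t w := v x + w - C * (t - edge_coord G m x) ^+ 2 <= v (curve G m t).
have [|m mx|m mx|p [pE Hp]] := @slopes_of_rays x g A.
- exact: opposite_slopes ax bx ab gab.
- have [_ cx] := edge_coordP mx.
  by rewrite /A cx subrr expr0n /= mulr0 subr0 !addr0.
- by apply: filterS (Hv m mx) => s Hs s0; rewrite /A ray_coordB; exact: Hs.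
have [phi [cphi dphi minphi]] := test_below nx.1 Hp.
exists phi; split=> // m mx; have [cm _] := asboolP _ mx.
by rewrite -pE //; exact: dphi.
Qed.

(** At a vertex, g a + g b = 0 is the (j,k)-differentiability condition. *)
Lemma jk_derivable_rays i a b (g : J * bool -> R) (phi : 'rV[R]_N -> R) :
  is_ray (vtx G i) a -> is_ray (vtx G i) b -> g a + g b = 0 ->
  (forall m : J * bool, is_ray (vtx G i) m -> edge_derivable G m.1 phi (vtx G i) /\
     edge_derive G m.1 phi (vtx G i) = ray_sign m.2 * g m) ->
  jk_derivable G i a.1 b.1 phi.
Proof.
move=> ai bi gab dphi; have [da ea] := dphi _ ai; have [db eb] := dphi _ bi.
by split=> //; rewrite ea eb (orient_ray ai) (orient_ray bi) !ray_signK.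
Qed.

(** The subsolution inequality at the centre of the star, for vertices and for
    interior points of edges alike. *)
Lemma subsolution_star u x a b (g : J * bool -> R) C :
  subsolution G H f Omega u -> net G x -> Omega x ->
  is_ray x a -> is_ray x b -> a != b -> g a + g b = 0 ->
  (forall m : J * bool, is_ray x m -> \forall s \near (0 : R), 0 <= s ->
     u (curve G m.1 (ray_coord x m s)) <= u x + g m * s + C * s ^+ 2) ->
  H a.1 (edge_coord G a.1 x) (ray_sign a.2 * g a) <= f x.
Proof.
move=> subu nx Ox ax bx ab gab Hu.
have [phi [cphi dphi maxphi]] := test_above_star nx ax bx ab gab Hu.
have [ca _] := asboolP _ ax; have [cb _] := asboolP _ bx.
have [da ea] := dphi _ ax; rewrite -ea.
have [[nvx _]|[[i _ ix] ab1]] := rays_opposite ax bx ab.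
  exact: (subsol_edge subu (edge_of_point nvx ca) Ox cphi da maxphi).
have nbi : ~ bnd G i by move=> bi; apply: nx.2; exists i.
rewrite -ix in ca cb Ox ax bx maxphi dphi *.
apply: (subsol_vertex subu nbi Ox ca cb ab1 cphi _ maxphi).
exact: jk_derivable_rays ax bx gab dphi.
Qed.

(** The ray b is the other direction at an interior point, and the edge k provided
    by the definition of a supersolution at a vertex. *)
Lemma supersolution_star v x a :
  supersolution G H f Omega v -> net G x -> Omega x -> is_ray x a ->
  exists b, [/\ is_ray x b, b != a & forall (g : J * bool -> R) C,
    g a + g b = 0 ->
    (forall m : J * bool, is_ray x m -> \forall s \near (0 : R), 0 <= s ->
       v x + g m * s - C * s ^+ 2 <= v (curve G m.1 (ray_coord x m s))) ->
    f x <= H a.1 (edge_coord G a.1 x) (ray_sign a.2 * g a)].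
Proof.
move=> supv nx Ox ax; have [ca _] := asboolP _ ax.
have [vx|nvx] := pselect (vertices G x); last first.
  have bx := opposite_ray nvx ax.
  have ab : a != (a.1, ~~ a.2) by case: (a) => j []; rewrite xpair_eqE eqxx.
  exists (a.1, ~~ a.2); split=> //; first by rewrite eq_sym.
  move=> g C gab Hv.
  have [phi [cphi dphi minphi]] := test_below_star nx ax bx ab gab Hv.
  have [da ea] := dphi _ ax; rewrite -ea.
  exact: (supersol_edge supv (edge_of_point nvx ca) Ox cphi da minphi).
have [i _ ix] := vx.
have nbi : ~ bnd G i by move=> bi; apply: nx.2; exists i.
rewrite -ix in nx Ox ax ca *.
have [k [ck ka Hk]] := supersol_vertex supv nbi Ox ca.
have [c kx] := cedge_ray ck.
have ab : a != (k, c) by apply: contraNneq ka => ->.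
exists (k, c); split=> //; first by rewrite eq_sym.
move=> g C gab Hv.
have [phi [cphi dphi minphi]] := test_below_star nx ax kx ab gab Hv.
have [_ ea] := dphi _ ax; rewrite -ea.
exact: (Hk _ cphi (jk_derivable_rays ax kx gab dphi) minphi).
Qed.

End Tests.

(** * Comparison *)

Lemma near_ray x a (Q : R -> Prop) : is_ray x a ->
  (\forall t \near edge_coord G a.1 x, 0 <= t <= len G a.1 -> Q t) ->
  \forall d \near (0:R)^'+, d < ray_room x a /\
    forall s, 0 <= s <= d -> Q (ray_coord x a s).
Proof.
move=> ax HQ; have [_ r0] := asboolP _ ax.
have H0 : \forall t \near edge_coord G a.1 x + ray_sign a.2 * 0,
  0 <= t <= len G a.1 -> Q t by rewrite mulr0 addr0.
have H1 : \forall d \near (0:R)^'+, forall s, 0 <= s <= d ->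
    0 <= ray_coord x a s <= len G a.1 -> Q (ray_coord x a s).
  by apply: near_right; apply: filterS (near_affine H0) => s + _.
have H2 : \forall d \near (0:R)^'+, d < ray_room x a by exact: nbhs_right_lt.
apply: filterS2 H1 H2 => d H1 H2; split=> // s hs; apply: H1 => //.
by apply: ray_coord_itv => //; lra.
Qed.

Lemma curve_lower_semicontinuous (w : 'rV[R]_N -> R) j t (e : R) :
  @lower_semicontinuous (subspace (cnet G)) R (fun y => (w y)%:E) ->
  0 <= t <= len G j -> 0 < e ->
  \forall s \near t, 0 <= s <= len G j -> w (curve G j t) - e < w (curve G j s).
Proof.
move=> lsc ht e0.
have ct : cnet G (curve G j t) by exists j => //; apply/cedgeP; exists t.
apply: (@curve_cvg_within _ _ (fun y => w (curve G j t) - e < w y)) => //.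
exact: lower_semicontinuous_near.
Qed.

(** The rays at a maximum point form a star to which [star_contradiction]
    applies, with c half of - f x and with r so small that the coercivity
    threshold, the bound f <= - c and the domain Omega are uniform on it. *)
Lemma net_max_contradiction (H : J -> R -> R -> R) (f u v : 'rV[R]_N -> R)
    (Omega : set 'rV[R]_N) x :
  eikonal G H -> subsolution G H f Omega u -> supersolution G H (fun=> 0) Omega v ->
  net G x -> f x < 0 -> {within net G, continuous f} ->
  (\forall y \near x, net G y -> Omega y) ->
  (forall y, cnet G y -> u y - v y <= u x - v x) -> False.
Proof.
move=> eikH subu supv nx fx0 cf Ox maxx.
pose c := - f x / 2; have c0 : 0 < c by rewrite /c; lra.
have Oxx : Omega x by exact: (nbhs_singleton Ox nx).
have fnear : \forall y \near x, net G y -> f y <= - c.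
  have /subspace_continuousP/(_ x nx)/cvgrPdist_lt/(_ _ c0) := cf.
  move=> Hf; have {}Hf : \forall y \near x, net G y -> `|f x - f y| < c by exact: Hf.
  apply: filterS Hf => y Hy ny; have := Hy ny.
  by rewrite ltr_norml /c => /andP[]; lra.
have good : \forall y \near x, cnet G y -> net G y -> Omega y /\ f y <= - c.
  by apply: filterS2 Ox fnear => y H1 H2 _ ny; split; [exact: H1|exact: H2].
have [P HP] : exists P, forall a, is_ray x a ->
    \forall t \near edge_coord G a.1 x, 0 <= t <= len G a.1 ->
    forall p, P <= `|p| -> 0 <= H a.1 t p.
  suff HP (a : J * bool) : \forall P \near +oo, is_ray x a ->
      \forall t \near edge_coord G a.1 x, 0 <= t <= len G a.1 ->
      forall p, P <= `|p| -> 0 <= H a.1 t p.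
    exact: filter_ex (filter_forall _ HP).
  have [ax|nax] := boolP (is_ray x a); last by apply: (filterS _ filterT) => P _.
  have [ca _] := asboolP _ ax; have [ht _] := edge_coordP ca.
  by apply: filterS (eikonal_coercive_near eikH ht) => P.
have [r [r0 Hr]] : exists r, 0 < r /\ forall a, is_ray x a -> r < ray_room x a /\
    forall s, 0 <= s <= r -> (forall p, P <= `|p| -> 0 <= H a.1 (ray_coord x a s) p) /\
    (net G (curve G a.1 (ray_coord x a s)) ->
     Omega (curve G a.1 (ray_coord x a s)) /\ f (curve G a.1 (ray_coord x a s)) <= - c).
  suff Hd (a : J * bool) : \forall d \near (0:R)^'+, is_ray x a -> d < ray_room x a /\
    forall s, 0 <= s <= d -> (forall p, P <= `|p| -> 0 <= H a.1 (ray_coord x a s) p) /\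
    (net G (curve G a.1 (ray_coord x a s)) ->
     Omega (curve G a.1 (ray_coord x a s)) /\ f (curve G a.1 (ray_coord x a s)) <= - c).
    exact: filter_ex (filterI (nbhs_right_gt (0:R)) (filter_forall _ Hd)).
  have [ax|nax] := boolP (is_ray x a); last by apply: (filterS _ filterT) => d _.
  have [ca _] := asboolP _ ax; have [ht cx] := edge_coordP ca.
  have := @near_ray x a (fun t => (forall p, P <= `|p| -> 0 <= H a.1 t p) /\
    (net G (curve G a.1 t) -> Omega (curve G a.1 t) /\ f (curve G a.1 t) <= - c)) ax.
  move=> /(_ _)/wrap[|Hd]; last by apply: filterS Hd.
  rewrite -{1}cx in good; have good' := curve_cvg_within ht good.
  by apply: filterS2 (HP _ ax) good' => t H1 H2 ht'; split; [exact: H1|exact: H2].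
pose U a s := u (curve G a.1 (ray_coord x a s)).
pose V a s := v (curve G a.1 (ray_coord x a s)).
pose h a s p := H a.1 (ray_coord x a s) (ray_sign a.2 * p).
have Ux a : is_ray x a -> U a 0 = u x by move=> ax; rewrite /U (ray_coord0 ax).2.
have Vx a : is_ray x a -> V a 0 = v x by move=> ax; rewrite /V (ray_coord0 ax).2.
have itvP a s : is_ray x a -> 0 <= s <= r -> 0 <= ray_coord x a s <= len G a.1.
  by move=> ax hs; apply: ray_coord_itv => //; have [] := Hr _ ax; lra.
have insideP a s : is_ray x a -> 0 < s < r -> 0 < ray_coord x a s < len G a.1.
  by move=> ax hs; apply: ray_coord_inside => //; have [] := Hr _ ax; lra.
have lscP w a s e : @lower_semicontinuous (subspace (cnet G)) R (fun y => (w y)%:E) ->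
    is_ray x a -> 0 <= s <= r -> 0 < e -> \forall s' \near s, 0 <= s' <= r ->
    w (curve G a.1 (ray_coord x a s)) - e < w (curve G a.1 (ray_coord x a s')).
  move=> lsc ax hs e0.
  have H1 := curve_lower_semicontinuous lsc (itvP _ _ ax hs) e0.
  by apply: filterS (near_affine H1) => s' + hs'; apply; exact: itvP.
have signs b (y z : R) : ray_sign b * y * z = y * (ray_sign b * z).
  by rewrite mulrAC mulrC mulrCA.
have [j0 _ cj0] := nx.1; have [b0 a0x] := cedge_ray cj0.
apply: (@star_contradiction R (J * bool)%type (is_ray x) U V h r c P r0 c0) a0x.
- by move=> a b ax bx; rewrite !Ux.
- by move=> a b ax bx; rewrite !Vx.
- move=> a s ax hs e e0.
  have := lscP _ a s e (subsol_usc subu) ax hs e0.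
  by apply: filterS => s' Hs hs'; have := Hs hs'; rewrite /U; lra.
- by move=> a s ax hs e e0; exact: lscP (supersol_lsc supv) ax hs e0.
- move=> a s ax hs; rewrite (Ux _ ax) (Vx _ ax); apply: maxx.
  by exists a.1 => //; apply/cedgeP; exists (ray_coord x a s) => //; exact: itvP.
- move=> a p ax e e0.
  have [ca _] := asboolP _ ax; have [ht cx] := edge_coordP ca.
  have H1 := eikonal_near (ray_sign a.2 * p) eikH ht e0.
  have Hs : ray_coord x a z.1 @[z --> ((0 : R), p)] --> edge_coord G a.1 x.
    rewrite -[X in _ --> X]addr0 -[X in _ --> _ + X](mulr0 (ray_sign a.2)).
    by apply: cvgD; [exact: cvg_cst|apply: cvgMr; exact: cvg_fst].
  have Hp : ray_sign a.2 * z.2 @[z --> ((0 : R), p)] --> ray_sign a.2 * p.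
    by apply: cvgMr; exact: cvg_snd.
  have H3 : \forall z \near ((0 : R), p), 0 <= ray_coord x a z.1 <= len G a.1 ->
      `|H a.1 (edge_coord G a.1 x) (ray_sign a.2 * p) -
        H a.1 (ray_coord x a z.1) (ray_sign a.2 * z.2)| < e.
    exact: (cvg_pair Hs Hp H1).
  have H4 : \forall z \near ((0:R), p), z.1 < r.
    by apply: (@near_fst _ 0 p (fun s => s < r)); exact: lt_nbhsl.
  apply: filterS2 H3 H4 => z H3 zr z0; rewrite /h (ray_coord0 ax).1 distrC.
  by apply: H3; apply: itvP => //; rewrite z0 ltW.
- move=> a b p ax bx ab; rewrite /h (ray_coord0 ax).1 (ray_coord0 bx).1.
  have [[nvx ->]|[[i _ ix] ab1]] := rays_opposite ax bx ab.
    by rewrite /= /ray_sign; case: a.2; rewrite /= ?mul1r ?mulN1r ?opprK.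
  have [ca _] := asboolP _ ax; have [cb _] := asboolP _ bx; rewrite -ix in ca cb *.
  have even q := eikonal_even eikH q cb.
  rewrite (eikonal_vertex eikH _ ca cb) /ray_sign.
  by case: a.2; case: b.2; rewrite ?mul1r ?mulN1r ?opprK // -even.
- move=> a s p ax hs Pp; have [_ Ha] := Hr _ ax.
  have hs' : 0 <= s <= r by lra.
  have [] := Ha s hs'; move=> + _; apply.
  by rewrite normrM /ray_sign; case: a.2; rewrite ?normrN normr1 mul1r.
- move=> a s p C ax hs Hs; have [_ Ha] := Hr _ ax.
  have hs' : 0 <= s <= r by lra.
  have [_ /(_ (inside_net (insideP _ _ ax hs)))[Oy fy]] := Ha s hs'.
  apply: le_trans fy.
  apply: (@subsolution_inside _ _ _ _ _ _ _ C subu (insideP _ _ ax hs) Oy).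
  apply: filterS (@near_ray_coord x a _ _ Hs) => t.
  by rewrite /U ray_coordK [s + _]addrC addrK ray_sign_sqr signs.
- move=> a s p C ax hs Hs; have [_ Ha] := Hr _ ax.
  have hs' : 0 <= s <= r by lra.
  have [_ /(_ (inside_net (insideP _ _ ax hs)))[Oy fy]] := Ha s hs'.
  apply: (@supersolution_inside _ _ _ _ _ _ _ C supv (insideP _ _ ax hs) Oy).
  apply: filterS (@near_ray_coord x a _ _ Hs) => t.
  by rewrite /V ray_coordK [s + _]addrC addrK ray_sign_sqr signs.
- move=> a b ax bx ab g C gab Hg; rewrite /h (ray_coord0 ax).1.
  have fc : f x <= - c by exact: (nbhs_singleton fnear).
  apply: le_trans fc.
  apply: (@subsolution_star _ _ _ _ _ _ _ _ C subu nx Oxx ax bx ab gab) => m mx.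
  by apply: filterS (Hg m mx) => s Hs s0; have := Hs s0; rewrite Ux.
- move=> a ax; have [b [bx ba Hb]] := supersolution_star supv nx Oxx ax.
  exists b; split=> // g C gab Hg; rewrite /h (ray_coord0 ax).1.
  apply: (Hb g C gab) => m mx.
  by apply: filterS (Hg m mx) => s Hs s0; have := Hs s0; rewrite Vx.
Qed.

Lemma difference_max (u v : 'rV[R]_N -> R) :
  usc_on (cnet G) u -> lsc_on (cnet G) v -> cnet G !=set0 ->
  exists2 x, cnet G x & forall y, cnet G y -> u y - v y <= u x - v x.
Proof.
move=> uscu lscv [_ [j0 _ [t0 ht0 _]]].
have [|j t _ /=||j [t [_ /= ht Hmax]]] := @usc_family_max R R J xpredT
  (fun j => `[0, len G j]%classic)
  (fun j t => u (curve G j t) - v (curve G j t)).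
- by move=> j _; exact: segment_compact.
- rewrite in_itv /= => ht e e0; have e2 : 0 < e / 2 by lra.
  have H1 := curve_lower_semicontinuous uscu ht e2.
  have H2 := curve_lower_semicontinuous lscv ht e2.
  apply: filterS2 H1 H2 => s H1 H2; rewrite in_itv /= => hs.
  by have := H1 hs; have := H2 hs; lra.
- by exists j0, t0.
exists (curve G j t); first by exists j => //; exists t.
by move=> _ [k _ [s hs <-]]; exact: Hmax.
Qed.

End Network.

Unset Implicit Arguments.

Theorem theorem5p1 (R : realType) (N : nat) (I J : finType)
  (G : network_data R N I J) (netG : is_network G)
  (H : J -> R -> R -> R) (eikH : eikonal G H)
  (K : set 'rV[R]_N) (K_net : K `<=` net G)
  (K_closed : @closed (subspace (net G)) K)
  (f : 'rV[R]_N -> R) (f_cont : {within net G, continuous f})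
  (f_neg : forall x, (net G `\` K) x -> f x < 0)
  (u v : 'rV[R]_N -> R)
  (u_sub : subsolution G H f (net G `\` K) u)
  (v_super : supersolution G H (fun=> 0) (net G `\` K) v)
  (u_le_v : forall x, (bnet G `|` K) x -> u x <= v x) :
  forall x, cnet G x -> u x <= v x.
Proof.
move=> y cy.
have [|||x cx maxx] := @difference_max _ _ _ _ G netG u v.
- exact: (subsol_usc u_sub).
- exact: (supersol_lsc v_super).
- by exists y.
have [bKx|nbKx] := pselect ((bnet G `|` K) x).
  by have := maxx _ cy; have := u_le_v _ bKx; lra.
exfalso.
have nx : net G x by split=> // bx; apply: nbKx; left.
have nKx : ~ K x by move=> Kx; apply: nbKx; right.
apply: (net_max_contradiction netG eikH u_sub v_super nx) => //.
  exact: f_neg.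
have /closed_subspaceP[W cW WK] := K_closed.
have nWx : ~ W x by move=> Wx; apply: nKx; have [] : (K `&` net G) x by rewrite -WK.
have : \forall z \near x, (~` W) z.
  by apply: open_nbhs_nbhs; split=> //; exact: closed_openC.
apply: filterS => z nWz nz; split=> // Kz; apply: nWz.
by have [] : (W `&` net G) z by rewrite WK.
Qed.
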